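(* Let $S\subset\mathbf{R}^d$ be a Gutkin billiard table. Every geodesic curve of $S$ which at some point $p$ is tangent to a principal direction of $S$ lies in the 2-plane through $p$ spanned by this direction and the normal line to $S$ at $p$. Moreover, this geodesic is tangent to a principal direction of $S$ at every point of it.
   Context: A Gutkin billiard table in $\mathbf{R}^d$ is a smooth closed hypersurface $S$ bounding a compact convex domain, with all principal curvatures strictly positive everywhere, for which there exists $\delta\in(0,\pi/2)$ such that for every pair of distinct points $p,q\in S$: if the angle between $\overrightarrow{pq}$ and $T_pS$ equals $\delta$, then the angle between $\overrightarrow{pq}$ and $T_qS$ also equals $\delta$. A principal direction at $p$ is an eigenvector of the shape operator of $S$ at $p$. *)

(* Defs.v *)
From Stdlib Require Import Reals Lra Lia.
Open Scope R_scope.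

(** Points/vectors of R^d are represented as functions [nat -> R] whose
    coordinates of index >= d vanish (predicate [vec d]). *)
Definition vec (d : nat) (x : nat -> R) : Prop := forall i, (d <= i)%nat -> x i = 0.

Definition vadd (x y : nat -> R) : nat -> R := fun i => x i + y i.
Definition vsub (x y : nat -> R) : nat -> R := fun i => x i - y i.
Definition vscale (c : R) (x : nat -> R) : nat -> R := fun i => c * x i.
Definition ebasis (i : nat) : nat -> R := fun j => if Nat.eqb i j then 1 else 0.

Fixpoint sumR (n : nat) (f : nat -> R) : R :=
  match n with O => 0 | S n' => sumR n' f + f n' end.

Definition dot (d : nat) (x y : nat -> R) : R := sumR d (fun i => x i * y i).
Definition norm (d : nat) (x : nat -> R) : R := sqrt (dot d x x).

Definition continuous_Rd (d : nat) (f : (nat -> R) -> R) : Prop :=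
  forall x, vec d x -> forall eps, 0 < eps -> exists del, 0 < del /\
    forall y, vec d y -> norm d (vsub y x) < del -> Rabs (f y - f x) < eps.

Fixpoint Ck (d : nat) (k : nat) (f : (nat -> R) -> R) : Prop :=
  match k with
  | O => continuous_Rd d f
  | S k' => continuous_Rd d f /\
      forall i, (i < d)%nat -> exists g : (nat -> R) -> R,
        (forall x, vec d x ->
           derivable_pt_lim (fun t => f (vadd x (vscale t (ebasis i)))) 0 (g x))
        /\ Ck d k' g
  end.

Definition smooth_Rd (d : nat) (f : (nat -> R) -> R) : Prop := forall k, Ck d k f.

Definition is_gradient (d : nat) (F : (nat -> R) -> R) (G : (nat -> R) -> nat -> R) : Prop :=
  forall x, vec d x -> vec d (G x) /\
    forall i, (i < d)%nat ->
      derivable_pt_lim (fun t => F (vadd x (vscale t (ebasis i)))) 0 (G x i).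

Definition surf (d : nat) (F : (nat -> R) -> R) (x : nat -> R) : Prop :=
  vec d x /\ F x = 0.

Definition normal (d : nat) (G : (nat -> R) -> nat -> R) (x : nat -> R) : nat -> R :=
  vscale (/ norm d (G x)) (G x).

Definition tangent (d : nat) (G : (nat -> R) -> nat -> R) (p v : nat -> R) : Prop :=
  vec d v /\ dot d v (normal d G p) = 0.

(** v is an eigenvector, with eigenvalue lam, of the shape operator at p,
    i.e. of the differential dN_p of the Gauss map restricted to T_pS:
    dN_p(v) = lam v. *)
Definition shape_eigen (d : nat) (G : (nat -> R) -> nat -> R) (p v : nat -> R) (lam : R) : Prop :=
  tangent d G p v /\ v <> (fun _ => 0) /\
  forall i, (i < d)%nat ->
    derivable_pt_lim (fun t => normal d G (vadd p (vscale t v)) i) 0 (lam * v i).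

Definition principal_direction (d : nat) (G : (nat -> R) -> nat -> R) (p v : nat -> R) : Prop :=
  exists lam, shape_eigen d G p v lam.

(** Angle between a nonzero vector w and the hyperplane with unit normal n. *)
Definition angle_hyp (d : nat) (w n : nat -> R) : R :=
  asin (Rabs (dot d w n) / (norm d w * norm d n)).

(** F is a regular defining function of a smooth closed hypersurface
    S = F^{-1}(0) bounding the compact convex domain K = {F <= 0},
    with gradient field G, and all principal curvatures positive. *)
Definition convex_hypersurface (d : nat) (F : (nat -> R) -> R) (G : (nat -> R) -> nat -> R) : Prop :=
  smooth_Rd d F /\ is_gradient d F G /\
  (forall p, surf d F p -> G p <> (fun _ => 0)) /\
  (exists M, forall x, vec d x -> F x <= 0 -> norm d x <= M) /\
  (forall x y t, vec d x -> vec d y -> F x <= 0 -> F y <= 0 -> 0 <= t <= 1 ->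
     F (vadd (vscale (1 - t) x) (vscale t y)) <= 0) /\
  (forall p v lam, surf d F p -> shape_eigen d G p v lam -> 0 < lam).

Definition gutkin_table (d : nat) (F : (nat -> R) -> R) (G : (nat -> R) -> nat -> R) : Prop :=
  convex_hypersurface d F G /\
  exists delta, 0 < delta < PI / 2 /\
    forall p q, surf d F p -> surf d F q -> p <> q ->
      angle_hyp d (vsub q p) (normal d G p) = delta ->
      angle_hyp d (vsub q p) (normal d G q) = delta.

Definition geodesic (d : nat) (F : (nat -> R) -> R) (G : (nat -> R) -> nat -> R)
  (a b : R) (gam gam1 gam2 : R -> nat -> R) : Prop :=
  a < b /\
  forall t, a < t < b ->
    surf d F (gam t) /\ vec d (gam1 t) /\ vec d (gam2 t) /\
    (forall i, (i < d)%nat -> derivable_pt_lim (fun s => gam s i) t (gam1 t i)) /\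
    (forall i, (i < d)%nat -> derivable_pt_lim (fun s => gam1 s i) t (gam2 t i)) /\
    gam1 t <> (fun _ => 0) /\
    (exists mu, gam2 t = vscale mu (normal d G (gam t))).

(* Main.v *)
From Coquelicot Require Import Coquelicot.
From Stdlib Require Import Reals Lra Lia FunctionalExtensionality ClassicalEpsilon.
Require Import Defs.
Open Scope R_scope.

(** The billiard map preserves the canonical symplectic form of the cotangent bundle of
    the table, and by the Gutkin property it preserves the hypersurface of covectors of
    length [cos delta]; hence it preserves the characteristics of that hypersurface,
    which are the geodesics.  Infinitesimally: let [p] run along a geodesic with unit
    tangent [v] and outer normal [N], let [e = cos delta v - sin delta N] be the chord
    direction, [q = p + L e] its other end, [M] the normal at [q] and
    [u = (e - sin delta M) / cos delta].  Then [q'] is a multiple of [u] and [u'] is a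
    multiple of [M].  Written out, these two facts express [e'], [N'], [M'] as linear
    combinations of [e], [N], [M], so a fixed vector orthogonal to all three at one time
    stays orthogonal to them.  If [v] is principal at some time, then [M] lies in the
    plane of [v] and [N] at that time; that plane is therefore constant, and [N'], being
    orthogonal to [N] inside it, is a multiple of [v]. *)

(** * Vectors and curves *)

(** The system for [e], [N], [M] closes because [e'] is known in three ways: at [p] it is
    [k cos delta N - sin delta N']; at [q] it is [sin delta M'] plus a multiple of [M]; and
    [q' = p' + L' e + L e'], a multiple of [u], gives it through [e], [N], [M] alone. The third
    relation determines [e'] and, as [sin delta] is not zero, the other two give [N'] and [M'], so
    the curvature at both ends is eliminated. At a principal time [N'] is a multiple of [v], hence
    [e'] and [q'] lie in the plane of [v] and [N]; since [q'] does not vanish, [M] lies there too.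
    The facts about [q'] and [u'] come from testing the symplectic identity against arbitrary
    variations at [q]. These are carried back to [p] without inverting the billiard map: the
    reversed chord leaves [q] at the same angle [delta], so it belongs to the same family. The
    curves are only known to be differentiable: the length [L] comes from an implicit function
    argument that gives no continuity of [L']. Uniqueness for the linear system is therefore
    obtained from a Gronwall estimate, with coefficients bounded by means of the geometric
    relations. *)

Lemma sumR_ext (n : nat) (f g : nat -> R) :
  (forall i, (i < n)%nat -> f i = g i) -> sumR n f = sumR n g.
Proof.
  induction n as [|n IH]; intros H; simpl; [reflexivity|].
  rewrite IH, H; [reflexivity|lia|intros i Hi; apply H; lia].
Qed.

Lemma sumR_plus (n : nat) (f g : nat -> R) :
  sumR n (fun i => f i + g i) = sumR n f + sumR n g.
Proof. induction n as [|n IH]; simpl; [ring|rewrite IH; ring]. Qed.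

Lemma sumR_scale (n : nat) (c : R) (f : nat -> R) :
  sumR n (fun i => c * f i) = c * sumR n f.
Proof. induction n as [|n IH]; simpl; [ring|rewrite IH; ring]. Qed.

Lemma sumR_le (n : nat) (f g : nat -> R) :
  (forall i, (i < n)%nat -> f i <= g i) -> sumR n f <= sumR n g.
Proof.
  induction n as [|n IH]; intros H; simpl; [lra|].
  assert (H1 : f n <= g n) by (apply H; lia).
  assert (H2 : sumR n f <= sumR n g) by (apply IH; intros i Hi; apply H; lia).
  lra.
Qed.

Lemma Rabs_sumR (n : nat) (f : nat -> R) :
  Rabs (sumR n f) <= sumR n (fun i => Rabs (f i)).
Proof.
  induction n as [|n IH]; simpl; [rewrite Rabs_R0; lra|].
  eapply Rle_trans; [apply Rabs_triang|lra].
Qed.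

Lemma sumR_exchange (n m : nat) (f : nat -> nat -> R) :
  sumR n (fun i => sumR m (f i)) = sumR m (fun j => sumR n (fun i => f i j)).
Proof.
  induction n as [|n IH]; simpl.
  - induction m as [|m IH]; simpl; [reflexivity|rewrite <- IH; ring].
  - rewrite IH, <- sumR_plus. reflexivity.
Qed.

Lemma dot_ext (d : nat) (x y x' y' : nat -> R) :
  (forall i, (i < d)%nat -> x i = x' i) -> (forall i, (i < d)%nat -> y i = y' i) ->
  dot d x y = dot d x' y'.
Proof. intros Hx Hy. apply sumR_ext. intros i Hi. now rewrite Hx, Hy. Qed.

Lemma dot_comm (d : nat) (x y : nat -> R) : dot d x y = dot d y x.
Proof. apply sumR_ext. intros; ring. Qed.

Lemma dot_vadd_l (d : nat) (x y z : nat -> R) :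
  dot d (vadd x y) z = dot d x z + dot d y z.
Proof. unfold dot. rewrite <- sumR_plus. apply sumR_ext. intros; unfold vadd; ring. Qed.

Lemma dot_vscale_l (d : nat) (c : R) (x z : nat -> R) :
  dot d (vscale c x) z = c * dot d x z.
Proof. unfold dot. rewrite <- sumR_scale. apply sumR_ext. intros; unfold vscale; ring. Qed.

Lemma vsub_vadd (x y : nat -> R) : vsub x y = vadd x (vscale (-1) y).
Proof. apply functional_extensionality; intros i; unfold vsub, vadd, vscale; ring. Qed.

Lemma dot_vsub_l (d : nat) (x y z : nat -> R) :
  dot d (vsub x y) z = dot d x z - dot d y z.
Proof. rewrite vsub_vadd, dot_vadd_l, dot_vscale_l. ring. Qed.

Lemma dot_vadd_r (d : nat) (x y z : nat -> R) :
  dot d z (vadd x y) = dot d z x + dot d z y.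
Proof. rewrite dot_comm, dot_vadd_l, (dot_comm d x), (dot_comm d y). ring. Qed.

Lemma dot_vscale_r (d : nat) (c : R) (x z : nat -> R) :
  dot d z (vscale c x) = c * dot d z x.
Proof. rewrite dot_comm, dot_vscale_l, (dot_comm d x). ring. Qed.

Lemma dot_vsub_r (d : nat) (x y z : nat -> R) :
  dot d z (vsub x y) = dot d z x - dot d z y.
Proof. rewrite dot_comm, dot_vsub_l, (dot_comm d x), (dot_comm d y). ring. Qed.

Lemma dot_0_r (d : nat) (x : nat -> R) : dot d x (fun _ => 0) = 0.
Proof.
  unfold dot. rewrite (sumR_ext d _ (fun i => 0 * x i)) by (intros; ring).
  rewrite sumR_scale. ring.
Qed.

Ltac dot_expand :=
  repeat (rewrite ?dot_vadd_l, ?dot_vadd_r, ?dot_vsub_l, ?dot_vsub_r,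
                  ?dot_vscale_l, ?dot_vscale_r).

Lemma dot_self_ge0 (d : nat) (x : nat -> R) : 0 <= dot d x x.
Proof.
  unfold dot. induction d as [|d IH]; simpl; [lra|].
  pose proof (Rle_0_sqr (x d)). unfold Rsqr in *. lra.
Qed.

Lemma dot_self_coord_le (d : nat) (x : nat -> R) (i : nat) :
  (i < d)%nat -> x i * x i <= dot d x x.
Proof.
  induction d as [|d IH]; intros Hi; [lia|].
  change (dot (S d) x x) with (dot d x x + x d * x d).
  destruct (Nat.eq_dec i d) as [->|Hn].
  - pose proof (dot_self_ge0 d x). lra.
  - assert (x i * x i <= dot d x x) by (apply IH; lia).
    pose proof (Rle_0_sqr (x d)). unfold Rsqr in *. lra.
Qed.

Lemma dot_self_eq0 (d : nat) (x : nat -> R) :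
  vec d x -> dot d x x = 0 -> x = (fun _ => 0).
Proof.
  intros Hx H. apply functional_extensionality; intros i.
  destruct (Nat.lt_ge_cases i d) as [Hi|Hi]; [|now apply Hx].
  pose proof (dot_self_coord_le d x i Hi). nra.
Qed.

Lemma dot_self_gt0 (d : nat) (x : nat -> R) :
  vec d x -> x <> (fun _ => 0) -> 0 < dot d x x.
Proof.
  intros Hx Hn. destruct (dot_self_ge0 d x) as [H|H]; [exact H|].
  exfalso. apply Hn. now apply (dot_self_eq0 d).
Qed.

(** The first two squares give the inequality multiplied by [dot d y y] or by [dot d x x], enough
    when one of these is positive; when both vanish, the squares of [x - y] and [x + y] force
    [dot d x y = 0]. *)
Lemma cauchy_schwarz (d : nat) (x y : nat -> R) :
  dot d x y * dot d x y <= dot d x x * dot d y y.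
Proof.
  pose proof (dot_self_ge0 d x) as Hx. pose proof (dot_self_ge0 d y) as Hy.
  pose proof (dot_self_ge0 d (vsub (vscale (dot d y y) x) (vscale (dot d x y) y))) as H1.
  pose proof (dot_self_ge0 d (vsub (vscale (dot d x x) y) (vscale (dot d x y) x))) as H2.
  pose proof (dot_self_ge0 d (vsub x y)) as H3.
  pose proof (dot_self_ge0 d (vadd x y)) as H4.
  revert H1 H2 H3 H4. dot_expand. rewrite (dot_comm d y x). intros H1 H2 H3 H4.
  destruct Hy as [Hy|Hy]; [apply (Rmult_le_reg_l (dot d y y)); lra|].
  destruct Hx as [Hx|Hx]; [apply (Rmult_le_reg_l (dot d x x)); lra|].
  nra.
Qed.

Lemma norm_sqr (d : nat) (x : nat -> R) : norm d x * norm d x = dot d x x.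
Proof. apply sqrt_sqrt, dot_self_ge0. Qed.

Lemma norm_ge0 (d : nat) (x : nat -> R) : 0 <= norm d x.
Proof. apply sqrt_pos. Qed.

Lemma norm_gt0 (d : nat) (x : nat -> R) : 0 < dot d x x -> 0 < norm d x.
Proof. apply sqrt_lt_R0. Qed.

Lemma norm_eq1 (d : nat) (x : nat -> R) : dot d x x = 1 -> norm d x = 1.
Proof. intros H. unfold norm. rewrite H. apply sqrt_1. Qed.

Lemma vec_vadd (d : nat) (x y : nat -> R) : vec d x -> vec d y -> vec d (vadd x y).
Proof. intros Hx Hy i Hi. unfold vadd. rewrite Hx, Hy by assumption. ring. Qed.

Lemma vec_vscale (d : nat) (c : R) (x : nat -> R) : vec d x -> vec d (vscale c x).
Proof. intros Hx i Hi. unfold vscale. rewrite Hx by assumption. ring. Qed.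

Lemma vec_vsub (d : nat) (x y : nat -> R) : vec d x -> vec d y -> vec d (vsub x y).
Proof. intros Hx Hy i Hi. unfold vsub. rewrite Hx, Hy by assumption. ring. Qed.

Lemma vec_ebasis (d i : nat) : (i < d)%nat -> vec d (ebasis i).
Proof.
  intros Hi j Hj. unfold ebasis. destruct (Nat.eqb_spec i j); [lia|reflexivity].
Qed.

#[local] Hint Resolve vec_vadd vec_vscale vec_vsub vec_ebasis : vecs.

Lemma vec_ext (d : nat) (x y : nat -> R) :
  vec d x -> vec d y -> (forall i, (i < d)%nat -> x i = y i) -> x = y.
Proof.
  intros Hx Hy H. apply functional_extensionality; intros i.
  destruct (Nat.lt_ge_cases i d) as [Hi|Hi]; [now apply H|].
  now rewrite Hx, Hy.
Qed.

(** * Continuity of coordinates, dot products and composites with functions on R^d *)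

Lemma continuous_sumR (U : UniformSpace) (n : nat) (f : nat -> U -> R) (u : U) :
  (forall i, (i < n)%nat -> continuous (f i) u) ->
  continuous (fun w => sumR n (fun i => f i w)) u.
Proof.
  induction n as [|n IH]; intros H; simpl.
  - apply continuous_const.
  - apply (continuous_plus (fun w => sumR n (fun i => f i w)) (f n)).
    + apply IH. intros i Hi; apply H; lia.
    + apply H; lia.
Qed.

Lemma continuous_Rmult (U : UniformSpace) (f g : U -> R) (u : U) :
  continuous f u -> continuous g u -> continuous (fun w => f w * g w) u.
Proof. intros Hf Hg. exact (continuous_mult f g u Hf Hg). Qed.

Lemma continuous_Rplus (U : UniformSpace) (f g : U -> R) (u : U) :
  continuous f u -> continuous g u -> continuous (fun w => f w + g w) u.
Proof. intros Hf Hg. exact (continuous_plus f g u Hf Hg). Qed.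

Lemma continuous_Rminus (U : UniformSpace) (f g : U -> R) (u : U) :
  continuous f u -> continuous g u -> continuous (fun w => f w - g w) u.
Proof. intros Hf Hg. exact (continuous_minus f g u Hf Hg). Qed.

Lemma continuous_dot (U : UniformSpace) (d : nat) (x y : U -> nat -> R) (u : U) :
  (forall i, (i < d)%nat -> continuous (fun w => x w i) u) ->
  (forall i, (i < d)%nat -> continuous (fun w => y w i) u) ->
  continuous (fun w => dot d (x w) (y w)) u.
Proof.
  intros Hx Hy. apply (continuous_sumR U d (fun i w => x w i * y w i)).
  intros i Hi. apply continuous_Rmult; auto.
Qed.

Lemma continuous_near (U : UniformSpace) (f : U -> R) (u : U) (eps : R) :
  continuous f u -> 0 < eps -> locally u (fun w => Rabs (f w - f u) < eps).
Proof.
  intros H He. apply (proj1 (filterlim_locally f (f u)) H (mkposreal eps He)).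
Qed.

Lemma locally_norm_vsub_lt (U : UniformSpace) (d : nat) (x : U -> nat -> R) (u : U) (del : R) :
  (forall i, (i < d)%nat -> continuous (fun w => x w i) u) -> 0 < del ->
  locally u (fun w => norm d (vsub (x w) (x u)) < del).
Proof.
  intros Hx Hdel.
  assert (Hc : continuous (fun w => dot d (vsub (x w) (x u)) (vsub (x w) (x u))) u).
  { apply continuous_dot; intros i Hi;
      apply (continuous_Rminus U (fun w => x w i) (fun w => x u i));
      auto using continuous_const. }
  assert (Hd2 : 0 < del * del) by nra.
  generalize (continuous_near U _ u _ Hc Hd2). apply filter_imp. intros w Hw.
  assert (H0 : dot d (vsub (x u) (x u)) (vsub (x u) (x u)) = 0) by (dot_expand; ring).
  rewrite H0, Rminus_0_r in Hw. apply Rabs_def2 in Hw.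
  unfold norm. rewrite <- (sqrt_square del) by lra.
  apply sqrt_lt_1_alt. split; [apply dot_self_ge0|lra].
Qed.

Lemma continuous_Rd_comp (U : UniformSpace) (d : nat) (f : (nat -> R) -> R)
    (x : U -> nat -> R) (u : U) :
  continuous_Rd d f -> (forall w, vec d (x w)) ->
  (forall i, (i < d)%nat -> continuous (fun w => x w i) u) ->
  continuous (fun w => f (x w)) u.
Proof.
  intros Hf Hv Hx. apply filterlim_locally. intros eps.
  destruct (Hf (x u) (Hv u) eps (cond_pos eps)) as (del & Hdel & H).
  generalize (locally_norm_vsub_lt U d x u del Hx Hdel). apply filter_imp.
  intros w Hw. exact (H (x w) (Hv w) Hw).
Qed.

(** * Coordinatewise differentiation of curves *)

Definition is_vderive (d : nat) (c : R -> nat -> R) (t : R) (c' : nat -> R) : Prop :=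
  forall i, (i < d)%nat -> is_derive (fun s => c s i) t (c' i).

Lemma is_derive_continuous (f : R -> R) (t l : R) : is_derive f t l -> continuous f t.
Proof. intros H. apply (ex_derive_continuous f). now exists l. Qed.

Lemma is_derive_eq (f : R -> R) (t l l' : R) : is_derive f t l -> l = l' -> is_derive f t l'.
Proof. now intros H <-. Qed.

Lemma is_derive_Rplus (f g : R -> R) (t a b : R) :
  is_derive f t a -> is_derive g t b -> is_derive (fun s => f s + g s) t (a + b).
Proof. intros Hf Hg. exact (is_derive_plus f g t a b Hf Hg). Qed.

Lemma is_derive_Rminus (f g : R -> R) (t a b : R) :
  is_derive f t a -> is_derive g t b -> is_derive (fun s => f s - g s) t (a - b).
Proof. intros Hf Hg. exact (is_derive_minus f g t a b Hf Hg). Qed.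

Lemma is_derive_Rmult (f g : R -> R) (t a b : R) :
  is_derive f t a -> is_derive g t b ->
  is_derive (fun s => f s * g s) t (a * g t + f t * b).
Proof. intros Hf Hg. exact (is_derive_mult f g t a b Hf Hg Rmult_comm). Qed.

Lemma is_derive_Rconst (c t : R) : is_derive (fun _ => c) t 0.
Proof. exact (is_derive_const c t). Qed.

Lemma is_vderive_vadd (d : nat) (c k : R -> nat -> R) (t : R) (c' k' : nat -> R) :
  is_vderive d c t c' -> is_vderive d k t k' ->
  is_vderive d (fun s => vadd (c s) (k s)) t (vadd c' k').
Proof. intros Hc Hk i Hi. apply is_derive_Rplus; auto. Qed.

Lemma is_vderive_vsub (d : nat) (c k : R -> nat -> R) (t : R) (c' k' : nat -> R) :
  is_vderive d c t c' -> is_vderive d k t k' ->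
  is_vderive d (fun s => vsub (c s) (k s)) t (vsub c' k').
Proof. intros Hc Hk i Hi. apply is_derive_Rminus; auto. Qed.

Lemma is_vderive_vscale (d : nat) (a : R -> R) (c : R -> nat -> R) (t a' : R) (c' : nat -> R) :
  is_derive a t a' -> is_vderive d c t c' ->
  is_vderive d (fun s => vscale (a s) (c s)) t (vadd (vscale a' (c t)) (vscale (a t) c')).
Proof. intros Ha Hc i Hi. apply (is_derive_Rmult a (fun s => c s i)); auto. Qed.

Lemma is_vderive_const (d : nat) (x : nat -> R) (t : R) :
  is_vderive d (fun _ => x) t (fun _ => 0).
Proof. intros i Hi. apply is_derive_Rconst. Qed.

Lemma is_vderive_vscale_const (d : nat) (a : R) (c : R -> nat -> R) (t : R) (c' : nat -> R) :
  is_vderive d c t c' -> is_vderive d (fun s => vscale a (c s)) t (vscale a c').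
Proof.
  intros Hc i Hi. eapply is_derive_eq.
  - apply (is_derive_Rmult (fun _ => a) (fun s => c s i)); [apply is_derive_Rconst|auto].
  - unfold vscale; ring.
Qed.

Lemma is_vderive_eq (d : nat) (c : R -> nat -> R) (t : R) (c' k' : nat -> R) :
  is_vderive d c t c' -> (forall i, (i < d)%nat -> c' i = k' i) -> is_vderive d c t k'.
Proof. intros H He i Hi. rewrite <- He by assumption. auto. Qed.

Lemma is_vderive_unique (d : nat) (c : R -> nat -> R) (t : R) (c' k' : nat -> R) :
  is_vderive d c t c' -> is_vderive d c t k' -> forall i, (i < d)%nat -> c' i = k' i.
Proof.
  intros Hc Hk i Hi. rewrite <- (is_derive_unique _ _ _ (Hc i Hi)).
  apply is_derive_unique; auto.
Qed.

Lemma is_derive_sumR (n : nat) (f : nat -> R -> R) (t : R) (l : nat -> R) :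
  (forall i, (i < n)%nat -> is_derive (f i) t (l i)) ->
  is_derive (fun s => sumR n (fun i => f i s)) t (sumR n l).
Proof.
  induction n as [|n IH]; intros H; simpl.
  - apply is_derive_Rconst.
  - apply is_derive_Rplus; [apply IH; intros i Hi; apply H|apply H]; lia.
Qed.

Lemma is_derive_dot (d : nat) (c k : R -> nat -> R) (t : R) (c' k' : nat -> R) :
  is_vderive d c t c' -> is_vderive d k t k' ->
  is_derive (fun s => dot d (c s) (k s)) t (dot d c' (k t) + dot d (c t) k').
Proof.
  intros Hc Hk. unfold dot at 2 3. rewrite <- sumR_plus.
  apply (is_derive_sumR d (fun i s => c s i * k s i)).
  intros i Hi. apply (is_derive_Rmult (fun s => c s i) (fun s => k s i)); auto.
Qed.

Lemma is_derive_dot_const (d : nat) (c : R -> nat -> R) (t : R) (c' y : nat -> R) :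
  is_vderive d c t c' -> is_derive (fun s => dot d (c s) y) t (dot d c' y).
Proof.
  intros Hc. eapply is_derive_eq.
  - apply (is_derive_dot d c (fun _ => y)); [exact Hc|apply is_vderive_const].
  - rewrite dot_0_r. ring.
Qed.

(** Used to differentiate the constraints (unit length, tangency, constant angle), which hold only
    near the time considered. *)
Lemma is_derive_loc_const (f : R -> R) (t l k : R) :
  is_derive f t l -> locally t (fun s => f s = k) -> l = 0.
Proof.
  intros H Hl.
  assert (H0 : is_derive f t 0).
  { apply (is_derive_ext_loc (fun _ => k)); [|apply is_derive_Rconst].
    revert Hl. apply filter_imp. auto. }
  rewrite <- (is_derive_unique _ _ _ H). now apply is_derive_unique.
Qed.

(* The coefficient [a] of [c t] plays no role: only the part of the derivative
   orthogonal to [c t] is ever used. *)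
Lemma is_vderive_normalize (d : nat) (c : R -> nat -> R) (t : R) (c' : nat -> R) :
  0 < dot d (c t) (c t) -> is_vderive d c t c' ->
  exists a, is_vderive d (fun s => vscale (/ norm d (c s)) (c s)) t
              (vadd (vscale a (c t)) (vscale (/ norm d (c t)) c')).
Proof.
  intros Hp Hc.
  pose proof (is_derive_dot d c c t c' c' Hc Hc) as Hd.
  assert (Hi : ex_derive (fun s => / norm d (c s)) t).
  { unfold norm.
    assert (He : ex_derive (fun x => / sqrt x) (dot d (c t) (c t))).
    { auto_derive. split; [exact Hp|]. split; [|exact I].
      apply Rgt_not_eq, sqrt_lt_R0, Hp. }
    apply (ex_derive_comp (fun x => / sqrt x) (fun s => dot d (c s) (c s))); [exact He|].
    eexists; exact Hd. }
  destruct Hi as [a Ha]. exists a.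
  apply (is_vderive_vscale d (fun s => / norm d (c s))); assumption.
Qed.

(** * Continuously differentiable functions on R^d *)

(** The partial derivatives are carried as data, so that the coordinates of the gradient can be fed
    to the same predicate, with the rows of the Hessian as [g]. *)
Definition is_C1 (d : nat) (f : (nat -> R) -> R) (g : (nat -> R) -> nat -> R) : Prop :=
  (forall x i, vec d x -> (i < d)%nat ->
     is_derive (fun t => f (vadd x (vscale t (ebasis i)))) 0 (g x i)) /\
  (forall i, (i < d)%nat -> continuous_Rd d (fun x => g x i)).

Lemma is_C1_derive_line (d : nat) (f : (nat -> R) -> R) (g : (nat -> R) -> nat -> R)
    (x : nat -> R) (i : nat) (s : R) :
  is_C1 d f g -> vec d x -> (i < d)%nat ->
  is_derive (fun t => f (vadd x (vscale t (ebasis i)))) s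
    (g (vadd x (vscale s (ebasis i))) i).
Proof.
  intros [Hf _] Hx Hi.
  assert (Hv : vec d (vadd x (vscale s (ebasis i)))) by auto with vecs.
  pose proof (Hf _ i Hv Hi) as H.
  assert (H0 : is_derive (fun t => t - s) s 1) by (auto_derive; [exact I|ring]).
  replace 0 with (s - s) in H by ring.
  pose proof (is_derive_comp _ (fun t => t - s) s _ 1 H H0) as Hc.
  eapply is_derive_eq; [|apply Rmult_1_l].
  eapply is_derive_ext; [|exact Hc].
  intros t. simpl. f_equal. apply functional_extensionality; intros j.
  unfold vadd, vscale. ring.
Qed.

Lemma norm_le_coord (d : nat) (x y : nat -> R) :
  (forall i, (i < d)%nat -> Rabs (x i) <= Rabs (y i)) -> norm d x <= norm d y.
Proof.
  intros H. apply sqrt_le_1_alt. apply sumR_le. intros i Hi.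
  apply Rsqr_le_abs_1, H, Hi.
Qed.

(** Walk from [x] to [y] one coordinate at a time: on each edge the mean value theorem yields a
    partial derivative at an intermediate point, and these values form [a]. An exact increment with
    a perturbed gradient replaces the usual error term of total differentiability. *)
Lemma is_C1_increment (d : nat) (f : (nat -> R) -> R) (g : (nat -> R) -> nat -> R)
    (x : nat -> R) (eps : R) :
  is_C1 d f g -> vec d x -> 0 < eps ->
  exists del, 0 < del /\ forall y, vec d y -> norm d (vsub y x) < del ->
    exists a, f y - f x = dot d a (vsub y x) /\
      forall i, (i < d)%nat -> Rabs (a i - g x i) < eps.
Proof.
  intros HC Hx He.
  (* Corners of the path: the first [m] coordinates are already those of [y], the others still those
     of [x]. *)
  set (mix := fun (m : nat) (y : nat -> R) (i : nat) => if Nat.ltb i m then y i else x i).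
  assert (Hmix : forall m y, vec d y -> vec d (mix m y)).
  { intros m y Hy i Hi. unfold mix. destruct (Nat.ltb i m); auto. }
  assert (Hind : forall m, (m <= d)%nat ->
    exists del, 0 < del /\ forall y, vec d y -> norm d (vsub y x) < del ->
    exists a, f (mix m y) - f x = sumR m (fun i => a i * vsub y x i) /\
      forall i, (i < m)%nat -> Rabs (a i - g x i) < eps).
  { induction m as [|m IH]; intros Hm.
    - exists 1. split; [lra|]. intros y Hy _. exists (fun _ => 0). split; [|intros; lia].
      simpl. replace (mix 0%nat y) with x; [ring|].
      apply functional_extensionality; intros i; reflexivity.
    - destruct IH as (del1 & Hd1 & IH); [lia|].
      destruct (proj2 HC m ltac:(lia) x Hx eps He) as (del2 & Hd2 & Hcont).
      exists (Rmin del1 del2). split; [now apply Rmin_glb_lt|].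
      intros y Hy Hn.
      destruct (IH y Hy) as (a & Ha & Ha').
      { eapply Rlt_le_trans; [exact Hn|apply Rmin_l]. }
      destruct (MVT_gen (fun s => f (vadd (mix m y) (vscale s (ebasis m)))) 0 (y m - x m)
                  (fun s => g (vadd (mix m y) (vscale s (ebasis m))) m)) as (xi & Hxi & Hf).
      { intros s _. apply (is_C1_derive_line d); [exact HC|auto|lia]. }
      { intros s _. apply continuity_pt_filterlim.
        eapply is_derive_continuous.
        apply (is_C1_derive_line d f g (mix m y) m s HC); [auto|lia]. }
      exists (fun i => if Nat.eqb i m then g (vadd (mix m y) (vscale xi (ebasis m))) m else a i).
      split.
      + simpl. rewrite Nat.eqb_refl.
        replace (f (mix (S m) y) - f x) with
          ((f (mix m y) - f x) + (f (mix (S m) y) - f (mix m y))) by ring.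
        rewrite Ha. f_equal.
        * apply sumR_ext. intros i Hi. destruct (Nat.eqb_spec i m); [lia|reflexivity].
        * rewrite Rminus_0_r in Hf. unfold vsub. rewrite <- Hf. f_equal; [|f_equal]; f_equal;
            apply functional_extensionality; intros i; unfold mix, vadd, vscale, ebasis.
          -- destruct (Nat.ltb_spec i (S m)), (Nat.ltb_spec i m), (Nat.eqb_spec m i);
               subst; try lia; ring.
          -- ring.
      + intros i Hi. destruct (Nat.eqb_spec i m) as [->|Hne]; [|apply Ha'; lia].
        apply Hcont; [auto with vecs|].
        eapply Rle_lt_trans; [|eapply Rlt_le_trans; [exact Hn|apply Rmin_r]].
        (* In each coordinate the intermediate point is at most as far from [x] as [y] is, so it
           lies in the ball where the partial derivative is controlled. *)
        apply norm_le_coord. intros i Hi'.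
        unfold vsub, vadd, vscale, mix, ebasis.
        destruct (Nat.ltb_spec i m), (Nat.eqb_spec m i); subst; try lia.
        * rewrite Rmult_0_r, Rplus_0_r. lra.
        * replace (x i + xi * 1 - x i) with xi by ring.
          revert Hxi. unfold Rmin, Rmax. destruct (Rle_dec 0 (y i - x i)); intros Hxi;
            unfold Rabs; destruct (Rcase_abs xi), (Rcase_abs (y i - x i)); lra.
        * replace (x i + xi * 0 - x i) with 0 by ring. rewrite Rabs_R0. apply Rabs_pos. }
  destruct (Hind d (le_n d)) as (del & Hdel & H). exists del. split; [exact Hdel|].
  intros y Hy Hn. destruct (H y Hy Hn) as (a & Ha & Ha'). exists a. split; [|exact Ha'].
  unfold dot. rewrite <- Ha. f_equal. f_equal. apply (vec_ext d); auto.
  intros i Hi. unfold mix. destruct (Nat.ltb_spec i d); [reflexivity|lia].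
Qed.

Lemma locally_forall_lt (U : UniformSpace) (u : U) (n : nat) (P : nat -> U -> Prop) :
  (forall i, (i < n)%nat -> locally u (P i)) ->
  locally u (fun w => forall i, (i < n)%nat -> P i w).
Proof.
  induction n as [|n IH]; intros H.
  - apply filter_forall. intros w i Hi. lia.
  - generalize (filter_and _ _ (IH (fun i Hi => H i (Nat.lt_trans _ _ _ Hi (Nat.lt_succ_diag_r n))))
                  (H n (Nat.lt_succ_diag_r n))).
    apply filter_imp. intros w [H1 H2] i Hi.
    destruct (Nat.eq_dec i n) as [->|Hne]; [exact H2|apply H1; lia].
Qed.

Lemma is_derive_quotient (f : R -> R) (t l : R) :
  is_derive f t l <->
  forall eps, 0 < eps ->
    locally 0 (fun h => h <> 0 -> Rabs ((f (t + h) - f t) / h - l) < eps).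
Proof.
  rewrite is_derive_Reals. split.
  - intros H eps He. destruct (H eps He) as [del Hd]. exists del.
    intros h Hh Hn. apply Hd; [exact Hn|].
    revert Hh. unfold ball; simpl; unfold AbsRing_ball, abs, minus, plus, opp; simpl.
    now rewrite Ropp_0, Rplus_0_r.
  - intros H eps He. destruct (H eps He) as [del Hd]. exists del.
    intros h Hn Hh. apply Hd; [|exact Hn].
    unfold ball; simpl; unfold AbsRing_ball, abs, minus, plus, opp; simpl.
    now rewrite Ropp_0, Rplus_0_r.
Qed.

Lemma continuous_shift0 (f : R -> R) (t : R) :
  continuous f t -> continuous (fun h => f (t + h)) 0.
Proof.
  intros H. apply (continuous_comp (fun h => t + h) f).
  - apply continuous_Rplus; [apply continuous_const|apply continuous_id].
  - now rewrite Rplus_0_r.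
Qed.

(** Dividing the exact increment by [h] leaves two errors: [a - g] paired with the difference
    quotient of [c], which is small because the quotients stay bounded, and the error of the scalar
    curve [dot d (c s) (g (c t))]. *)
Lemma is_C1_chain (d : nat) (f : (nat -> R) -> R) (g : (nat -> R) -> nat -> R)
    (c : R -> nat -> R) (t : R) (c' : nat -> R) :
  is_C1 d f g -> (forall s, vec d (c s)) -> is_vderive d c t c' ->
  is_derive (fun s => f (c s)) t (dot d (g (c t)) c').
Proof.
  intros HC Hv Hc. apply is_derive_quotient. intros eps He.
  (* [K - 1] bounds the sum of the absolute coordinates of the difference quotient once each is
     within 1 of [c' i]; the extra 1 makes [K] positive and the final estimate strict. *)
  set (K := 1 + sumR d (fun i => Rabs (c' i) + 1)).
  assert (HK : 0 < K).
  { assert (0 <= sumR d (fun i => Rabs (c' i) + 1)); [|unfold K; lra].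
    apply Rle_trans with (sumR d (fun i => 0 * 0)); [rewrite sumR_scale; lra|].
    apply sumR_le. intros i _. pose proof (Rabs_pos (c' i)). lra. }
  assert (Heta : 0 < eps / (2 * K)) by (apply Rdiv_lt_0_compat; lra).
  destruct (is_C1_increment d f g (c t) _ HC (Hv t) Heta) as (del & Hdel & Hinc).
  assert (L1 : locally 0 (fun h => norm d (vsub (c (t + h)) (c (t + 0))) < del)).
  { apply (locally_norm_vsub_lt R_UniformSpace d (fun h => c (t + h)) 0); [|exact Hdel].
    intros i Hi. apply (continuous_shift0 (fun s => c s i)).
    eapply is_derive_continuous. apply Hc, Hi. }
  assert (L2 : locally 0 (fun h => forall i, (i < d)%nat ->
             h <> 0 -> Rabs ((c (t + h) i - c t i) / h - c' i) < 1)).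
  { apply (locally_forall_lt R_UniformSpace 0 d
      (fun i h => h <> 0 -> Rabs ((c (t + h) i - c t i) / h - c' i) < 1)). intros i Hi.
    apply (proj1 (is_derive_quotient (fun s => c s i) t (c' i)) (Hc i Hi)). lra. }
  assert (L3 : locally 0 (fun h => h <> 0 ->
             Rabs ((dot d (c (t + h)) (g (c t)) - dot d (c t) (g (c t))) / h
                   - dot d c' (g (c t))) < eps / 2)).
  { apply (proj1 (is_derive_quotient (fun s => dot d (c s) (g (c t))) t _)
             (is_derive_dot_const d c t c' _ Hc)). lra. }
  generalize (filter_and _ _ L1 (filter_and _ _ L2 L3)). apply filter_imp.
  intros h (H1 & H2 & H3) Hh. rewrite Rplus_0_r in H1.
  destruct (Hinc _ (Hv (t + h)) H1) as (a & Ha & Ha').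
  rewrite Ha.
  replace (dot d a (vsub (c (t + h)) (c t)) / h - dot d (g (c t)) c') with
    (dot d (vsub a (g (c t))) (vscale (/ h) (vsub (c (t + h)) (c t))) +
     ((dot d (c (t + h)) (g (c t)) - dot d (c t) (g (c t))) / h - dot d c' (g (c t)))).
  2:{ dot_expand. rewrite !(dot_comm d (g (c t))). field. exact Hh. }
  eapply Rle_lt_trans; [apply Rabs_triang|].
  assert (Hb : Rabs (dot d (vsub a (g (c t))) (vscale (/ h) (vsub (c (t + h)) (c t))))
               <= eps / (2 * K) * (K - 1)).
  { eapply Rle_trans; [apply Rabs_sumR|].
    replace (K - 1) with (sumR d (fun i => Rabs (c' i) + 1)) by (unfold K; ring).
    rewrite <- sumR_scale. apply sumR_le. intros i Hi. rewrite Rabs_mult.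
    apply Rmult_le_compat; try apply Rabs_pos.
    - left. apply Ha', Hi.
    - unfold vscale, vsub. pose proof (H2 i Hi Hh) as Hq.
      replace (/ h * (c (t + h) i - c t i)) with (((c (t + h) i - c t i) / h - c' i) + c' i)
        by (field; exact Hh).
      eapply Rle_trans; [apply Rabs_triang|lra]. }
  assert (Hlast : eps / (2 * K) * (K - 1) < eps / 2).
  { replace (eps / 2) with (eps / (2 * K) * K) by (field; lra). apply Rmult_lt_compat_l; lra. }
  specialize (H3 Hh). lra.
Qed.

Definition ex_vderive (d : nat) (c : R -> nat -> R) (t : R) : Prop :=
  exists c', is_vderive d c t c'.

Lemma is_vderive_line (d : nat) (x v : nat -> R) (t : R) :
  is_vderive d (fun s => vadd x (vscale s v)) t v.
Proof.
  intros i Hi. unfold vadd, vscale. auto_derive; [exact I|ring].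
Qed.

(** Schwarz's theorem in the coordinate 2-plane [z] through [x]. It makes the shape operator
    self-adjoint, which is why the curvature terms cancel in the symplectic identity. *)
Lemma hessian_symmetric (d : nat) (f : (nat -> R) -> R) (g : (nat -> R) -> nat -> R)
    (h : (nat -> R) -> nat -> nat -> R) (x : nat -> R) (i j : nat) :
  is_C1 d f g -> (forall k, (k < d)%nat -> is_C1 d (fun y => g y k) (fun y => h y k)) ->
  vec d x -> (i < d)%nat -> (j < d)%nat -> h x j i = h x i j.
Proof.
  intros Hf Hg Hx Hi Hj.
  set (z := fun u v : R => vadd (vadd x (vscale u (ebasis i))) (vscale v (ebasis j))).
  assert (Hz : forall u v, z u v = vadd (vadd x (vscale v (ebasis j))) (vscale u (ebasis i))).
  { intros u v. apply functional_extensionality; intros k. unfold z, vadd. ring. }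
  assert (Hvz : forall u v, vec d (z u v)) by (intros; unfold z; auto with vecs).
  assert (Dv : forall (F : (nat -> R) -> R) F', is_C1 d F F' -> forall u v,
             is_derive (fun t => F (z u t)) v (F' (z u v) j)).
  { intros F F' HF u v. apply (is_C1_derive_line d F F'); auto with vecs. }
  assert (Du : forall (F : (nat -> R) -> R) F', is_C1 d F F' -> forall u v,
             is_derive (fun t => F (z t v)) u (F' (z u v) i)).
  { intros F F' HF u v. rewrite Hz.
    apply (is_derive_ext (fun t => F (vadd (vadd x (vscale v (ebasis j))) (vscale t (ebasis i))))).
    - intros t. now rewrite Hz.
    - apply (is_C1_derive_line d F F'); auto with vecs. }
  assert (E1 : forall u v, Derive (fun t => f (z u t)) v = g (z u v) j).
  { intros u v. apply is_derive_unique, Dv, Hf. }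
  assert (E2 : forall u v, Derive (fun t => f (z t v)) u = g (z u v) i).
  { intros u v. apply is_derive_unique, Du, Hf. }
  assert (D12 : forall u v, is_derive (fun w => Derive (fun t => f (z w t)) v) u (h (z u v) j i)).
  { intros u v. apply (is_derive_ext (fun w => g (z w v) j)); [intros; symmetry; apply E1|].
    apply (Du (fun y => g y j) (fun y => h y j)), Hg, Hj. }
  assert (D21 : forall u v, is_derive (fun w => Derive (fun t => f (z t w)) u) v (h (z u v) i j)).
  { intros u v. apply (is_derive_ext (fun w => g (z u w) i)); [intros; symmetry; apply E2|].
    apply (Dv (fun y => g y i) (fun y => h y i)), Hg, Hi. }
  assert (Hc : forall k l, (k < d)%nat -> (l < d)%nat ->
             continuity_2d_pt (fun u v => h (z u v) k l) 0 0).
  { intros k l Hk Hl. apply continuity_2d_pt_filterlim.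
    apply (continuous_Rd_comp (prod_UniformSpace R_UniformSpace R_UniformSpace) d
             (fun y => h y k l) (fun w => z (fst w) (snd w)) (0, 0)).
    - apply (proj2 (Hg k Hk)), Hl.
    - intros; apply Hvz.
    - intros n _. unfold z, vadd, vscale.
      repeat apply continuous_Rplus; try apply continuous_const;
        apply continuous_Rmult; try apply continuous_const;
        [apply continuous_fst|apply continuous_snd]. }
  pose proof (Schwarz (fun u v => f (z u v)) 0 0) as HS.
  assert (Hz0 : z 0 0 = x).
  { apply functional_extensionality; intros n; unfold z, vadd, vscale; ring. }
  rewrite <- Hz0.
  transitivity (Derive (fun u => Derive (fun t => f (z u t)) 0) 0);
    [symmetry; apply is_derive_unique, D12|].
  transitivity (Derive (fun v => Derive (fun t => f (z t v)) 0) 0);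
    [|apply is_derive_unique, D21].
  apply HS.
  - exists (mkposreal 1 Rlt_0_1). intros u v _ _.
    split; [eexists; apply Du, Hf|]. split; [eexists; apply Dv, Hf|].
    split; eexists; [apply D12|apply D21].
  - apply (continuity_2d_pt_ext (fun u v => h (z u v) j i)); [|auto].
    intros u v. symmetry. apply is_derive_unique, D12.
  - apply (continuity_2d_pt_ext (fun u v => h (z u v) i j)); [|auto].
    intros u v. symmetry. apply is_derive_unique, D21.
Qed.

(** Core of the implicit function theorem. For an equation f(w, tau w) = 0, [psi w] stands for f(w,
    tau s) and [phi w] for the mean value slope in the second variable, so that the relation between
    them is the equation itself. *)
Lemma implicit_derive (phi psi : R -> R) (tau : R -> R) (s psi' phi0 k : R) :
  0 < k -> k <= phi0 -> psi s = 0 -> is_derive psi s psi' ->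
  locally s (fun w => k <= phi w /\ phi w * (tau w - tau s) = - psi w) ->
  (forall eps, 0 < eps -> exists eta, 0 < eta /\
     locally s (fun w => Rabs (tau w - tau s) < eta -> Rabs (phi w - phi0) < eps)) ->
  is_derive tau s (- psi' / phi0).
Proof.
  intros Hk Hphi0 Hpsi Hd Hl Hphi.
  (* Continuity of [tau] comes first: [k] times [Rabs (tau w - tau s)] is at most [Rabs (psi w)],
     which tends to 0. Only then does the conditional hypothesis give the limit of [phi]. *)
  assert (Hcphi : forall eps, 0 < eps -> locally s (fun w => Rabs (phi w - phi0) < eps)).
  { intros eps He. destruct (Hphi eps He) as (eta & Heta & Hphi').
    assert (Hke : 0 < k * eta) by nra.
    generalize (filter_and _ _ Hl (filter_and _ _ Hphi'
      (continuous_near R_UniformSpace psi s _ (is_derive_continuous _ _ _ Hd) Hke))).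
    apply filter_imp. intros w ([H1 H2] & H3 & H4). apply H3.
    rewrite Hpsi, Rminus_0_r in H4.
    apply (Rmult_lt_reg_l k); [exact Hk|].
    eapply Rle_lt_trans; [|exact H4].
    rewrite <- (Rabs_Ropp (psi w)), <- H2, Rabs_mult, (Rabs_pos_eq (phi w)) by lra.
    apply Rmult_le_compat_r; [apply Rabs_pos|exact H1]. }
  apply is_derive_quotient. intros eps He.
  set (l := - psi' / phi0).
  pose proof (Rabs_pos l) as Hlp.
  assert (He1 : 0 < k * eps / 2) by nra.
  assert (He2 : 0 < k * eps / 2 / (Rabs l + 1)) by (apply Rdiv_lt_0_compat; lra).
  assert (Hshift : forall P : R -> Prop, locally s P -> locally 0 (fun h => P (s + h))).
  { intros P HP. apply (continuous_shift0 (fun w => w) s (continuous_id s)). now rewrite Rplus_0_r. }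
  generalize (filter_and _ _ (Hshift _ Hl) (filter_and _ _ (Hshift _ (Hcphi _ He2))
    (proj1 (is_derive_quotient psi s psi') Hd _ He1))).
  apply filter_imp. intros h ([H1 H2] & H3 & H4) Hh. specialize (H4 Hh).
  rewrite Hpsi, Rminus_0_r in H4.
  apply (Rmult_lt_reg_l k); [exact Hk|].
  set (Q := (tau (s + h) - tau s) / h).
  (* Multiplied by [phi], the error of the quotient splits into the error for [psi] and the error
     for [phi], each at most [k * eps / 2]. *)
  assert (HQ : phi (s + h) * (Q - l) =
     - (psi (s + h) / h - psi') - (phi (s + h) - phi0) * l).
  { replace (phi (s + h) * (Q - l)) with
      (phi (s + h) * (tau (s + h) - tau s) / h - phi (s + h) * l) by (unfold Q; field; exact Hh).
    rewrite H2. replace (- (psi (s + h) / h - psi')) with (- psi (s + h) / h - phi0 * l)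
      by (unfold l; field; split; [exact Hh|lra]). ring. }
  apply Rle_lt_trans with (Rabs (phi (s + h) * (Q - l))).
  - rewrite Rabs_mult, (Rabs_pos_eq (phi (s + h))) by lra.
    apply Rmult_le_compat_r; [apply Rabs_pos|exact H1].
  - rewrite HQ. unfold Rminus at 1. eapply Rle_lt_trans; [apply Rabs_triang|].
    rewrite !Rabs_Ropp, (Rabs_mult _ l).
    assert (Rabs (phi (s + h) - phi0) * Rabs l <= k * eps / 2).
    { apply Rle_trans with (k * eps / 2 / (Rabs l + 1) * (Rabs l + 1)); [|right; field; lra].
      apply Rmult_le_compat; try apply Rabs_pos; lra. }
    lra.
Qed.

(** The ray crosses the level set transversally at time [t1]. Since [c] and [m] are merely
    differentiable, the crossing parameter is obtained as a function differentiable at every nearby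
    time, with nothing said about continuity of [tau']. *)
Lemma implicit_ray (d : nat) (f : (nat -> R) -> R) (g : (nat -> R) -> nat -> R)
    (c m : R -> nat -> R) (t1 tau1 r eta : R) :
  is_C1 d f g -> (forall s, vec d (c s)) -> (forall s, vec d (m s)) -> 0 < r ->
  (forall s, Rabs (s - t1) < r -> ex_vderive d c s /\ ex_vderive d m s) ->
  f (vadd (c t1) (vscale tau1 (m t1))) = 0 ->
  0 < dot d (g (vadd (c t1) (vscale tau1 (m t1)))) (m t1) -> 0 < eta ->
  exists eps tau tau', 0 < eps /\ eps <= r /\ tau t1 = tau1 /\
    forall s, Rabs (s - t1) < eps ->
      Rabs (tau s - tau1) < eta /\ f (vadd (c s) (vscale (tau s) (m s))) = 0 /\
      is_derive tau s (tau' s).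
Proof.
  intros HC Hvc Hvm Hr Hder H0 Hpos Heta.
  set (x := fun s tau : R => vadd (c s) (vscale tau (m s))).
  set (phi := fun s tau : R => dot d (g (x s tau)) (m s)).
  assert (Hvx : forall s tau, vec d (x s tau)) by (intros; unfold x; auto with vecs).
  assert (Dtau : forall s tau, is_derive (fun w => f (x s w)) tau (phi s tau)).
  { intros s tau. apply (is_C1_chain d f g (fun w => x s w)); [exact HC|auto|].
    apply is_vderive_line. }
  assert (Ds : forall s tau, Rabs (s - t1) < r ->
             exists l, is_derive (fun w => f (x w tau)) s l).
  { intros s tau Hs. destruct (Hder s Hs) as [[c1 Hc1] [m1 Hm1]]. eexists.
    apply (is_C1_chain d f g (fun w => x w tau)); [exact HC|auto|].
    apply is_vderive_vadd; [exact Hc1|apply is_vderive_vscale_const, Hm1]. }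
  assert (Cphi : forall s tau, Rabs (s - t1) < r -> continuity_2d_pt phi s tau).
  { intros s tau Hs. apply continuity_2d_pt_filterlim.
    assert (Hcc : forall (q : R -> nat -> R), ex_vderive d q s -> forall i, (i < d)%nat ->
       continuous (T := prod_UniformSpace R_UniformSpace R_UniformSpace)
         (fun z => q (fst z) i) (s, tau)).
    { intros q [q1 Hq] i Hi.
      apply (continuous_comp (U := prod_UniformSpace R_UniformSpace R_UniformSpace)
               fst (fun w => q w i)); [apply continuous_fst|].
      eapply is_derive_continuous. apply Hq, Hi. }
    destruct (Hder s Hs) as [Hc1 Hm1].
    apply (continuous_dot (prod_UniformSpace R_UniformSpace R_UniformSpace) d
             (fun z => g (x (fst z) (snd z))) (fun z => m (fst z))); intros i Hi.
    - apply (continuous_Rd_comp (prod_UniformSpace R_UniformSpace R_UniformSpace) d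
               (fun y => g y i) (fun z => x (fst z) (snd z)) (s, tau)).
      + apply (proj2 HC), Hi.
      + intros; apply Hvx.
      + intros n Hn. unfold x, vadd, vscale.
        apply continuous_Rplus; [apply (Hcc c); auto|].
        apply continuous_Rmult; [apply continuous_snd|apply (Hcc m); auto].
    - apply (Hcc m); auto. }
  (* Half the slope at the base point bounds the slope from below on a whole box; this gives
     uniqueness of the zero there and the constant required by [implicit_derive]. *)
  set (k := phi t1 tau1 / 2).
  assert (Hk : 0 < k) by (unfold k, phi, x; lra).
  assert (Ht1 : Rabs (t1 - t1) < r) by (rewrite Rminus_diag, Rabs_R0; exact Hr).
  destruct (Cphi t1 tau1 Ht1 (mkposreal k Hk)) as [[del Hdel] Hbox]. simpl in Hbox.
  assert (Hbox' : forall s tau, Rabs (s - t1) < del -> Rabs (tau - tau1) < del -> k <= phi s tau).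
  { intros s tau Hs Ht. pose proof (Hbox s tau Hs Ht) as Hb. apply Rabs_def2 in Hb.
    unfold k in *. lra. }
  (* The halving keeps the closed interval of radius [e2] strictly inside both the box and the
     tolerance [eta]. *)
  set (e2 := Rmin del eta / 2).
  assert (He2 : 0 < e2 /\ e2 < del /\ e2 < eta).
  { unfold e2. pose proof (Rmin_l del eta). pose proof (Rmin_r del eta).
    assert (0 < Rmin del eta) by (now apply Rmin_glb_lt). lra. }
  assert (Hmvt : forall s ta tb, exists xi, Rmin ta tb <= xi <= Rmax ta tb /\
             f (x s tb) - f (x s ta) = phi s xi * (tb - ta)).
  { intros s ta tb. apply (MVT_gen (fun w => f (x s w)) ta tb (phi s)).
    - intros; apply Dtau.
    - intros w _. apply continuity_pt_filterlim. eapply is_derive_continuous, Dtau. }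
  assert (Hxi : forall a b xi, Rabs (a - tau1) <= e2 -> Rabs (b - tau1) <= e2 ->
             Rmin a b <= xi <= Rmax a b -> Rabs (xi - tau1) < del).
  { intros a b xi Ha Hb. unfold Rmin, Rmax.
    destruct (Rle_dec a b); intros Hxi; apply Rabs_def1;
      apply Rabs_le_between in Ha; apply Rabs_le_between in Hb; lra. }
  assert (Hup : 0 < f (x t1 (tau1 + e2))).
  { destruct (Hmvt t1 tau1 (tau1 + e2)) as (xi & Hx1 & Hx2).
    assert (k <= phi t1 xi).
    { apply Hbox'; [rewrite Rminus_diag, Rabs_R0; lra|].
      apply (Hxi tau1 (tau1 + e2)); [| |exact Hx1];
        [rewrite Rminus_diag, Rabs_R0; lra|].
      replace (tau1 + e2 - tau1) with e2 by ring. rewrite Rabs_pos_eq; lra. }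
    unfold x in Hx2 at 2. rewrite H0 in Hx2.
    replace (tau1 + e2 - tau1) with e2 in Hx2 by ring. nra. }
  assert (Hdn : f (x t1 (tau1 - e2)) < 0).
  { destruct (Hmvt t1 tau1 (tau1 - e2)) as (xi & Hx1 & Hx2).
    assert (k <= phi t1 xi).
    { apply Hbox'; [rewrite Rminus_diag, Rabs_R0; lra|].
      apply (Hxi tau1 (tau1 - e2)); [| |exact Hx1];
        [rewrite Rminus_diag, Rabs_R0; lra|].
      replace (tau1 - e2 - tau1) with (- e2) by ring. rewrite Rabs_Ropp, Rabs_pos_eq; lra. }
    unfold x in Hx2 at 2. rewrite H0 in Hx2.
    replace (tau1 - e2 - tau1) with (- e2) in Hx2 by ring. nra. }
  assert (Lsgn : locally t1 (fun s => 0 < f (x s (tau1 + e2)) /\ f (x s (tau1 - e2)) < 0)).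
  { destruct (Ds t1 (tau1 + e2) Ht1) as [l1 Hl1]. destruct (Ds t1 (tau1 - e2) Ht1) as [l2 Hl2].
    assert (Hdn' : 0 < - f (x t1 (tau1 - e2))) by lra.
    generalize (filter_and _ _
      (continuous_near R_UniformSpace _ _ _ (is_derive_continuous _ _ _ Hl1) Hup)
      (continuous_near R_UniformSpace _ _ _ (is_derive_continuous _ _ _ Hl2) Hdn')).
    apply filter_imp. intros s [Ha Hb]. apply Rabs_def2 in Ha, Hb. lra. }
  destruct Lsgn as [[del2 Hdel2] Hsgn].
  set (eps := Rmin r (Rmin del del2)).
  assert (Heps : 0 < eps /\ eps <= r /\ eps <= del /\ eps <= del2).
  { unfold eps. pose proof (Rmin_l r (Rmin del del2)). pose proof (Rmin_r r (Rmin del del2)).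
    pose proof (Rmin_l del del2). pose proof (Rmin_r del del2).
    assert (0 < Rmin r (Rmin del del2)) by (repeat apply Rmin_glb_lt; assumption). lra. }
  set (P := fun s tau => Rabs (tau - tau1) <= e2 /\ f (x s tau) = 0).
  assert (Hex : forall s, Rabs (s - t1) < eps -> exists tau, P s tau).
  { intros s Hs. destruct (Hsgn s) as [Hs1 Hs2]; [unfold ball; simpl; unfold AbsRing_ball, abs,
      minus, plus, opp; simpl; fold (s - t1); lra|].
    destruct (IVT_gen (fun w => f (x s w)) (tau1 - e2) (tau1 + e2) 0) as (z & Hz & Hfz).
    - intros w. apply continuity_pt_filterlim. eapply is_derive_continuous, Dtau.
    - split; [eapply Rle_trans; [apply Rmin_l|lra]|eapply Rle_trans; [|apply Rmax_r]; lra].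
    - exists z. split; [|exact Hfz]. rewrite Rmin_left, Rmax_right in Hz by lra.
      apply Rabs_le. lra. }
  (* The zero is picked by choice; uniqueness in the box makes the value at [t1] equal to [tau1]. *)
  set (tau := fun s => epsilon (inhabits 0) (P s)).
  assert (Htau : forall s, Rabs (s - t1) < eps -> P s (tau s)).
  { intros s Hs. apply epsilon_spec, Hex, Hs. }
  assert (Huniq : forall s a b, Rabs (s - t1) < eps -> P s a -> P s b -> a = b).
  { intros s a b Hs [Ha1 Ha2] [Hb1 Hb2]. destruct (Hmvt s a b) as (xi & Hx1 & Hx2).
    assert (k <= phi s xi) by (apply Hbox'; [lra|apply (Hxi a b); assumption]).
    rewrite Ha2, Hb2 in Hx2. nra. }
  assert (Hdtau : forall s, Rabs (s - t1) < eps -> exists l, is_derive tau s l).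
  { intros s Hs. destruct (Htau s Hs) as [Hs1 Hs2].
    assert (Hsr : Rabs (s - t1) < r) by lra.
    destruct (Ds s (tau s) Hsr) as [l Hl].
    (* A mean value point between [tau s] and [tau w] for each [w], so that the slope becomes a
       function of [w]. *)
    set (xi := fun w => epsilon (inhabits 0) (fun z =>
       Rmin (tau s) (tau w) <= z <= Rmax (tau s) (tau w) /\
       f (x w (tau w)) - f (x w (tau s)) = phi w z * (tau w - tau s))).
    assert (Hxiw : forall w, Rmin (tau s) (tau w) <= xi w <= Rmax (tau s) (tau w) /\
       f (x w (tau w)) - f (x w (tau s)) = phi w (xi w) * (tau w - tau s)).
    { intros w. apply (epsilon_spec (inhabits 0) (fun z =>
        Rmin (tau s) (tau w) <= z <= Rmax (tau s) (tau w) /\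
        f (x w (tau w)) - f (x w (tau s)) = phi w z * (tau w - tau s))). apply Hmvt. }
    assert (Lw : locally s (fun w => Rabs (w - t1) < eps)).
    { assert (Hg : 0 < eps - Rabs (s - t1)) by lra.
      generalize (continuous_near R_UniformSpace (fun w => w) s _ (continuous_id s) Hg).
      apply filter_imp. intros w Hw.
      replace (w - t1) with ((w - s) + (s - t1)) by ring.
      eapply Rle_lt_trans; [apply Rabs_triang|lra]. }
    exists (- l / phi s (tau s)).
    apply (implicit_derive (fun w => phi w (xi w)) (fun w => f (x w (tau s))) tau s l
             (phi s (tau s)) k); [exact Hk| |exact Hs2|exact Hl| |].
    - apply Hbox'; lra.
    - revert Lw. apply filter_imp. intros w Hw. destruct (Htau w Hw) as [Hw1 Hw2].
      destruct (Hxiw w) as [Hx1 Hx2]. split.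
      + apply Hbox'; [lra|]. apply (Hxi (tau s) (tau w)); assumption.
      + rewrite <- Hx2, Hw2. ring.
    - intros ep Hep. destruct (Cphi s (tau s) Hsr (mkposreal ep Hep)) as [[e3 He3] H3].
      simpl in H3. exists e3. split; [exact He3|].
      generalize (continuous_near R_UniformSpace (fun w => w) s _ (continuous_id s) He3).
      apply filter_imp. intros w Hw Htw. apply H3; [exact Hw|].
      destruct (Hxiw w) as [Hx1 _]. revert Hx1. unfold Rmin, Rmax.
      apply Rabs_def2 in Htw.
      destruct (Rle_dec (tau s) (tau w)); intros Hx1; apply Rabs_def1; lra. }
  exists eps, tau, (fun s => epsilon (inhabits 0) (fun l => is_derive tau s l)).
  split; [lra|]. split; [lra|].
  assert (Ht1e : Rabs (t1 - t1) < eps) by (rewrite Rminus_diag, Rabs_R0; lra).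
  split.
  - apply (Huniq t1 _ _ Ht1e (Htau t1 Ht1e)). split; [|exact H0].
    rewrite Rminus_diag, Rabs_R0; lra.
  - intros s Hs. destruct (Htau s Hs) as [Hs1 Hs2]. split; [lra|]. split; [exact Hs2|].
    apply (epsilon_spec (inhabits 0) (fun l => is_derive tau s l)), Hdtau, Hs.
Qed.

(** * Differential inequalities *)

Lemma derive_sign_le (f f' : R -> R) (a b : R) :
  a <= b -> (forall t, a <= t <= b -> is_derive f t (f' t) /\ 0 <= f' t) -> f a <= f b.
Proof.
  intros Hab Hf.
  destruct (MVT_gen f a b f') as (c & Hc & He).
  - rewrite Rmin_left, Rmax_right by exact Hab. intros t Ht. apply Hf. lra.
  - rewrite Rmin_left, Rmax_right by exact Hab. intros t Ht.
    apply continuity_pt_filterlim. eapply is_derive_continuous, Hf, Ht.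
  - rewrite Rmin_left, Rmax_right in Hc by exact Hab.
    pose proof (proj2 (Hf c Hc)). nra.
Qed.

Lemma derive_zero_const (f : R -> R) (a b : R) :
  (forall t, a < t < b -> is_derive f t 0) ->
  forall s t, a < s < b -> a < t < b -> f s = f t.
Proof.
  intros Hf s t Hs Ht.
  assert (Hin : forall z, Rmin s t <= z <= Rmax s t -> a < z < b).
  { intros z. unfold Rmin, Rmax. destruct (Rle_dec s t); lra. }
  destruct (MVT_gen f s t (fun _ => 0)) as (c & _ & He).
  - intros z Hz. apply Hf, Hin. lra.
  - intros z Hz. apply continuity_pt_filterlim. eapply is_derive_continuous, Hf, Hin, Hz.
  - lra.
Qed.

(** [g] times [exp (- K * t)] is non-increasing and [g] times [exp (K * t)] is non-decreasing, so a
    zero propagates forward and backward in time. *)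
Lemma gronwall_zero (g g' : R -> R) (K t1 eps ts t : R) :
  (forall s, Rabs (s - t1) < eps ->
     is_derive g s (g' s) /\ 0 <= g s /\ Rabs (g' s) <= K * g s) ->
  Rabs (ts - t1) < eps -> Rabs (t - t1) < eps -> g ts = 0 -> g t = 0.
Proof.
  intros Hg Hts Ht H0.
  assert (Hin : forall a b z, Rabs (a - t1) < eps -> Rabs (b - t1) < eps -> a <= z <= b ->
            Rabs (z - t1) < eps).
  { intros a b z Ha Hb Hz. apply Rabs_def2 in Ha, Hb. apply Rabs_def1; lra. }
  assert (De : forall (c s : R), is_derive (fun w => exp (c * w)) s (c * exp (c * s))).
  { intros c s. auto_derive; [exact I|ring]. }
  destruct (Hg t Ht) as (_ & Hge & _).
  destruct (Rle_lt_dec ts t) as [Hle|Hlt].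
  - assert (Hd : - (g ts * exp (- K * ts)) <= - (g t * exp (- K * t))).
    { apply (derive_sign_le (fun w => - (g w * exp (- K * w)))
               (fun w => (K * g w - g' w) * exp (- K * w))); [exact Hle|].
      intros s Hs. destruct (Hg s (Hin _ _ _ Hts Ht Hs)) as (D & _ & Hb).
      pose proof (exp_pos (- K * s)). pose proof (Rle_abs (g' s)). split; [|nra].
      eapply is_derive_eq;
        [apply (is_derive_opp (fun w => g w * exp (- K * w))), (is_derive_Rmult g (fun w => exp (- K * w))); [exact D|apply De]|].
      unfold opp; simpl. ring. }
    rewrite H0 in Hd. pose proof (exp_pos (- K * t)). nra.
  - assert (Hd : g t * exp (K * t) <= g ts * exp (K * ts)).
    { apply (derive_sign_le (fun w => g w * exp (K * w))
               (fun w => (K * g w + g' w) * exp (K * w))); [lra|].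
      intros s Hs. destruct (Hg s (Hin _ _ _ Ht Hts Hs)) as (D & _ & Hb).
      pose proof (exp_pos (K * s)). apply Rabs_le_between in Hb. split; [|nra].
      eapply is_derive_eq;
        [apply (is_derive_Rmult g (fun w => exp (K * w))); [exact D|apply De]|]. simpl. ring. }
    rewrite H0 in Hd. pose proof (exp_pos (K * t)). nra.
Qed.

(** Gronwall for the sum of squares: its derivative is at most [2 * K * (m * m)], and [m * m] is at
    most three times the sum of squares, hence the rate [6 * K]. A bound on the derivatives stands
    in for continuity of coefficients. *)
Lemma linear_system3_zero (A B C A' B' C' : R -> R) (K t1 eps ts t : R) :
  0 <= K ->
  (forall s, Rabs (s - t1) < eps ->
     is_derive A s (A' s) /\ is_derive B s (B' s) /\ is_derive C s (C' s) /\
     let m := Rabs (A s) + Rabs (B s) + Rabs (C s) in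
     Rabs (A' s) <= K * m /\ Rabs (B' s) <= K * m /\ Rabs (C' s) <= K * m) ->
  Rabs (ts - t1) < eps -> Rabs (t - t1) < eps ->
  A ts = 0 -> B ts = 0 -> C ts = 0 -> A t = 0 /\ B t = 0 /\ C t = 0.
Proof.
  intros HK Hs Hts Ht HA HB HC.
  enough (Hz : A t * A t + B t * B t + C t * C t = 0).
  { repeat split; nra. }
  apply (gronwall_zero (fun s => A s * A s + B s * B s + C s * C s)
           (fun s => (A' s * A s + A s * A' s) + (B' s * B s + B s * B' s)
                     + (C' s * C s + C s * C' s)) (6 * K) t1 eps ts t);
    [|exact Hts|exact Ht|rewrite HA, HB, HC; ring].
  intros s Hn. destruct (Hs s Hn) as (DA & DB & DC & HAb & HBb & HCb).
  split; [|split].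
  - apply is_derive_Rplus; [apply is_derive_Rplus|]; now apply is_derive_Rmult.
  - nra.
  - set (m := Rabs (A s) + Rabs (B s) + Rabs (C s)) in *.
    assert (Hm : forall x y, Rabs y <= K * m -> Rabs (y * x + x * y) <= 2 * (K * m) * Rabs x).
    { intros x y Hy. replace (y * x + x * y) with (2 * (y * x)) by ring.
      rewrite !Rabs_mult, (Rabs_pos_eq 2) by lra. pose proof (Rabs_pos x). nra. }
    eapply Rle_trans; [apply Rabs_triang|].
    eapply Rle_trans; [apply Rplus_le_compat_r, Rabs_triang|].
    pose proof (Hm (A s) _ HAb). pose proof (Hm (B s) _ HBb). pose proof (Hm (C s) _ HCb).
    apply Rle_trans with (2 * K * (m * m)); [unfold m in *; lra|].
    assert (m * m <= 3 * (A s * A s + B s * B s + C s * C s)).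
    { unfold m. pose proof (Rsqr_abs (A s)) as E1. pose proof (Rsqr_abs (B s)) as E2.
      pose proof (Rsqr_abs (C s)) as E3. unfold Rsqr in *. rewrite E1, E2, E3.
      pose proof (Rle_0_sqr (Rabs (A s) - Rabs (B s))).
      pose proof (Rle_0_sqr (Rabs (B s) - Rabs (C s))).
      pose proof (Rle_0_sqr (Rabs (A s) - Rabs (C s))). unfold Rsqr in *. lra. }
    nra.
Qed.

(** The local hypothesis transfers [P] between any two times near [t1]. At the supremum of the good
    times it therefore serves twice: to reach the supremum and to pass beyond it. *)
Lemma interval_propagation_right (P : R -> Prop) (t0 t : R) :
  t0 <= t -> P t0 ->
  (forall t1, t0 <= t1 <= t -> exists eps, 0 < eps /\
     forall s s', t0 <= s <= t -> t0 <= s' <= t ->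
       Rabs (s - t1) < eps -> Rabs (s' - t1) < eps -> P s -> P s') ->
  P t.
Proof.
  intros Hle H0 Hloc.
  set (E := fun x => t0 <= x <= t /\ P x).
  destruct (completeness E) as (m & Hub & Hlub).
  { exists t. intros x [Hx _]. lra. }
  { exists t0. split; [lra|exact H0]. }
  assert (Hm : t0 <= m <= t).
  { split; [apply Hub; split; [lra|exact H0]|]. apply Hlub. intros x [Hx _]. lra. }
  destruct (Hloc m Hm) as (eps & He & Hp).
  assert (Hx : exists x, E x /\ m - eps < x).
  { apply Classical_Prop.NNPP. intros Hn.
    assert (Hc : m <= m - eps); [|lra].
    apply Hlub. intros x Hx. destruct (Rle_lt_dec x (m - eps)) as [Hr|Hr]; [exact Hr|].
    exfalso. apply Hn. now exists x. }
  destruct Hx as (x & [Hxt HPx] & Hxm).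
  assert (Hxle : x <= m) by (apply Hub; split; assumption).
  assert (Hnew : forall y, t0 <= y <= t -> m - eps < y < m + eps -> P y).
  { intros y Hy Hym. apply (Hp x y); auto; apply Rabs_def1; lra. }
  destruct (Rlt_le_dec t (m + eps)) as [Hr|Hr]; [apply Hnew; lra|].
  exfalso. assert (m + eps / 2 <= m); [|lra].
  apply Hub. split; [lra|]. apply Hnew; lra.
Qed.

Lemma interval_propagation (P : R -> Prop) (a b t0 t : R) :
  (forall t1, a < t1 < b -> exists eps, 0 < eps /\
     forall s s', Rabs (s - t1) < eps -> Rabs (s' - t1) < eps -> P s -> P s') ->
  a < t0 < b -> a < t < b -> P t0 -> P t.
Proof.
  intros Hloc Ht0 Ht H0. destruct (Rle_lt_dec t0 t) as [Hle|Hlt].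
  - apply (interval_propagation_right P t0 t Hle H0).
    intros t1 Ht1. destruct (Hloc t1) as (eps & He & Hp); [lra|].
    exists eps. split; [exact He|]. intros s s' _ _. apply Hp.
  - assert (HP : P (- - t)); [|now rewrite Ropp_involutive in HP].
    apply (interval_propagation_right (fun x => P (- x)) (- t0) (- t)).
    + lra.
    + now rewrite Ropp_involutive.
    + intros t1 Ht1. destruct (Hloc (- t1)) as (eps & He & Hp); [lra|].
      exists eps. split; [exact He|]. intros s s' _ _ Hs Hs'.
      apply Hp; [replace (- s - - t1) with (- (s - t1)) by ring
                |replace (- s' - - t1) with (- (s' - t1)) by ring]; now rewrite Rabs_Ropp.
Qed.

(** * Chords of a Gutkin table *)

Section Hypersurface.

Variables (d : nat) (F : (nat -> R) -> R) (G : (nat -> R) -> nat -> R)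
  (H : (nat -> R) -> nat -> nat -> R).
Hypothesis HF : is_C1 d F G.
Hypothesis HG : forall k, (k < d)%nat -> is_C1 d (fun x => G x k) (fun x => H x k).
Hypothesis HGv : forall x, vec d x -> vec d (G x).
Hypothesis Hreg : forall p, surf d F p -> G p <> (fun _ => 0).

Local Notation N := (normal d G).
Local Notation "<< x , y >>" := (dot d x y).

Lemma vec_normal (x : nat -> R) : vec d x -> vec d (N x).
Proof. intros Hx. apply vec_vscale, HGv, Hx. Qed.

Lemma gradient_gt0 (p : nat -> R) : surf d F p -> 0 < << G p , G p >>.
Proof. intros Hp. apply dot_self_gt0; [apply HGv, Hp|apply Hreg, Hp]. Qed.

Lemma normal_unit_of_gradient (p : nat -> R) : 0 < << G p , G p >> -> << N p , N p >> = 1.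
Proof.
  intros Hp. pose proof (norm_gt0 _ _ Hp) as Hn. unfold normal. dot_expand.
  rewrite <- norm_sqr. field. lra.
Qed.

Lemma normal_unit (p : nat -> R) : surf d F p -> << N p , N p >> = 1.
Proof. intros Hp. now apply normal_unit_of_gradient, gradient_gt0. Qed.

Lemma dot_gradient (p y : nat -> R) : surf d F p -> << G p , y >> = norm d (G p) * << N p , y >>.
Proof.
  intros Hp. pose proof (norm_gt0 _ _ (gradient_gt0 p Hp)).
  unfold normal. dot_expand. field. lra.
Qed.

Lemma dot_gradient_eq0 (p y : nat -> R) : surf d F p -> << G p , y >> = 0 -> << N p , y >> = 0.
Proof.
  intros Hp. rewrite dot_gradient by assumption.
  pose proof (norm_gt0 _ _ (gradient_gt0 p Hp)). nra.
Qed.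

(** * The differential of the Gauss map *)

Definition scaled_hessian (x v : nat -> R) : nat -> R :=
  vscale (/ norm d (G x)) (fun i => << H x i , v >>).

(** On the surface this is the derivative of the normalized gradient in the direction [v], tangent
    or not: the scaled Hessian with its normal component removed. The sign is that of
    [shape_eigen]. *)
Definition shape (x v : nat -> R) : nat -> R :=
  vsub (scaled_hessian x v) (vscale << scaled_hessian x v , N x >> (N x)).

Lemma shape_ext (x v w : nat -> R) :
  (forall i, (i < d)%nat -> v i = w i) -> shape x v = shape x w.
Proof.
  intros Hvw. unfold shape.
  replace (scaled_hessian x w) with (scaled_hessian x v); [reflexivity|].
  apply functional_extensionality; intros i. unfold scaled_hessian, vscale. f_equal.
  apply dot_ext; auto.
Qed.

Lemma shape_vscale (x v : nat -> R) (a : R) : shape x (vscale a v) = vscale a (shape x v).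
Proof.
  assert (E : scaled_hessian x (vscale a v) = vscale a (scaled_hessian x v)).
  { apply functional_extensionality; intros i. unfold scaled_hessian, vscale at 1 3 4.
    rewrite dot_vscale_r. ring. }
  unfold shape. rewrite E, dot_vscale_l. apply functional_extensionality; intros i.
  unfold vsub, vscale. ring.
Qed.

Lemma shape_dot_normal (x v : nat -> R) : surf d F x -> << shape x v , N x >> = 0.
Proof.
  intros Hx. unfold shape. dot_expand. rewrite (normal_unit x Hx). ring.
Qed.

(** Against tangent vectors the normal projection is invisible, and the symmetric Hessian form
    remains. *)
Lemma shape_symmetric (x v w : nat -> R) :
  surf d F x -> << N x , v >> = 0 -> << N x , w >> = 0 ->
  << shape x v , w >> = << shape x w , v >>.
Proof.
  intros Hx Hv Hw. unfold shape. rewrite !dot_vsub_l, !(dot_vscale_l _ _ (N x)), Hv, Hw.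
  rewrite !Rmult_0_r, !Rminus_0_r.
  unfold scaled_hessian. rewrite !dot_vscale_l. f_equal.
  transitivity (sumR d (fun i => sumR d (fun j => H x i j * v j * w i))).
  { apply sumR_ext. intros i Hi. unfold dot. rewrite Rmult_comm, <- sumR_scale.
    apply sumR_ext. intros; ring. }
  rewrite sumR_exchange. apply sumR_ext. intros j Hj. unfold dot.
  rewrite Rmult_comm, <- sumR_scale. apply sumR_ext. intros i Hi.
  rewrite (hessian_symmetric d F G H x j i HF HG (proj1 Hx) Hj Hi). ring.
Qed.

(** Normalizing the gradient gives an unspecified multiple of [G] plus the scaled Hessian; the unit
    length of the normal fixes that multiple and turns the sum into [shape]. *)
Lemma normal_chain (c : R -> nat -> R) (t : R) (c' : nat -> R) :
  (forall s, vec d (c s)) -> is_vderive d c t c' -> surf d F (c t) ->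
  is_vderive d (fun s => N (c s)) t (shape (c t) c').
Proof.
  intros Hv Hc Ht.
  assert (HGc : is_vderive d (fun s => G (c s)) t (fun i => << H (c t) i , c' >>)).
  { intros i Hi. apply (is_C1_chain d (fun x => G x i) (fun x => H x i)); auto. }
  pose proof (gradient_gt0 _ Ht) as Hg.
  destruct (is_vderive_normalize d _ t _ Hg HGc) as [a Ha].
  change (is_vderive d (fun s => N (c s)) t
            (vadd (vscale a (G (c t))) (scaled_hessian (c t) c'))) in Ha.
  assert (H0 : << vadd (vscale a (G (c t))) (scaled_hessian (c t) c') , N (c t) >> = 0).
  { pose proof (is_derive_dot d _ _ t _ _ Ha Ha) as Hd.
    apply (is_derive_loc_const _ _ _ 1) in Hd.
    - rewrite (dot_comm d (N (c t))) in Hd. lra.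
    (* The curve is on the surface only at time [t]; nearby, a non-zero gradient, which persists by
       continuity, is enough for a unit normal. *)
    - pose proof (is_derive_dot d _ _ t _ _ HGc HGc) as Hd2.
      generalize (continuous_near R_UniformSpace _ t _ (is_derive_continuous _ _ _ Hd2) Hg).
      apply filter_imp. intros s Hs. apply Rabs_def2 in Hs.
      apply normal_unit_of_gradient. lra. }
  apply (is_vderive_eq d _ _ _ _ Ha). intros i Hi.
  pose proof (norm_gt0 _ _ Hg) as Hn.
  assert (HGN : G (c t) = vscale (norm d (G (c t))) (N (c t))).
  { apply functional_extensionality; intros j. unfold normal, vscale. field. lra. }
  rewrite HGN in H0 at 1. revert H0. dot_expand. rewrite (normal_unit _ Ht). intros H0.
  unfold shape, vadd, vsub, vscale.
  replace << scaled_hessian (c t) c' , N (c t) >> with (- (a * norm d (G (c t)))) by lra.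
  unfold normal at 1, vscale. field. lra.
Qed.

Lemma surface_curve_tangent (c : R -> nat -> R) (t : R) (c' : nat -> R) :
  (forall s, vec d (c s)) -> is_vderive d c t c' -> locally t (fun s => surf d F (c s)) ->
  << N (c t) , c' >> = 0.
Proof.
  intros Hv Hc Hs. apply dot_gradient_eq0; [apply (locally_singleton _ _ Hs)|].
  apply (is_derive_loc_const (fun s => F (c s)) t _ 0).
  - now apply is_C1_chain.
  - revert Hs. apply filter_imp. now intros s [_ Hs].
Qed.

(** The derivative in [shape_eigen] is taken along a straight line that leaves the surface;
    [normal_chain] covers such curves and makes the eigenvector equation algebraic. *)
Lemma shape_eigen_iff (p v : nat -> R) (lam : R) :
  surf d F p -> vec d v ->
  shape_eigen d G p v lam <->
  << v , N p >> = 0 /\ v <> (fun _ => 0) /\ forall i, (i < d)%nat -> shape p v i = lam * v i.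
Proof.
  intros Hp Hv.
  assert (Hl : is_vderive d (fun s => N (vadd p (vscale s v))) 0 (shape p v)).
  { pose proof (normal_chain (fun s => vadd p (vscale s v)) 0 v) as Hc. simpl in Hc.
    assert (E : vadd p (vscale 0 v) = p).
    { apply functional_extensionality; intros i. unfold vadd, vscale. ring. }
    rewrite E in Hc. apply Hc; [|apply is_vderive_line|exact Hp].
    intros s. apply vec_vadd; [apply Hp|now apply vec_vscale]. }
  unfold shape_eigen, tangent. split.
  - intros ([_ Ht] & Hn & Hd). split; [exact Ht|]. split; [exact Hn|].
    apply (is_vderive_unique d _ _ _ (fun i => lam * v i) Hl).
    intros i Hi. apply is_derive_Reals, Hd, Hi.
  - intros (Ht & Hn & Hd). split; [now split|]. split; [exact Hn|].
    intros i Hi. apply is_derive_Reals. rewrite <- Hd by exact Hi. apply Hl, Hi.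
Qed.

(** * Existence of the chords and their angles *)

Variables (delta Mb : R).
Hypothesis Hdelta : 0 < delta < PI / 2.
Hypothesis Hbounded : forall x, vec d x -> F x <= 0 -> norm d x <= Mb.
Hypothesis Hconvex : forall x y t, vec d x -> vec d y -> F x <= 0 -> F y <= 0 -> 0 <= t <= 1 ->
  F (vadd (vscale (1 - t) x) (vscale t y)) <= 0.
Hypothesis Hgutkin : forall p q, surf d F p -> surf d F q -> p <> q ->
  angle_hyp d (vsub q p) (N p) = delta -> angle_hyp d (vsub q p) (N q) = delta.

Definition unit_tangent (p v : nat -> R) : Prop :=
  vec d v /\ << v , v >> = 1 /\ << v , N p >> = 0.

(** Direction of the chord leaving [p] above the unit tangent vector [v]; the minus sign points
    inward because [N] is the outer normal. *)
Definition ray (p v : nat -> R) : nat -> R :=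
  vsub (vscale (cos delta) v) (vscale (sin delta) (N p)).

Lemma sin_delta_gt0 : 0 < sin delta.
Proof. apply sin_gt_0; pose proof PI_RGT_0; lra. Qed.

Lemma cos_delta_gt0 : 0 < cos delta.
Proof. apply cos_gt_0; lra. Qed.

Lemma sin2_cos2_delta : sin delta * sin delta + cos delta * cos delta = 1.
Proof. exact (sin2_cos2 delta). Qed.

Lemma vec_ray (p v : nat -> R) : vec d p -> vec d v -> vec d (ray p v).
Proof. intros Hp Hv. pose proof (vec_normal p Hp). unfold ray. auto with vecs. Qed.

Lemma ray_unit (p v : nat -> R) : surf d F p -> unit_tangent p v -> << ray p v , ray p v >> = 1.
Proof.
  intros Hp (_ & Hv & Ht). unfold ray. dot_expand.
  rewrite (dot_comm d (N p) v), Hv, Ht, (normal_unit p Hp).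
  pose proof sin2_cos2_delta. lra.
Qed.

Lemma ray_dot_normal (p v : nat -> R) :
  surf d F p -> unit_tangent p v -> << ray p v , N p >> = - sin delta.
Proof.
  intros Hp (_ & Hv & Ht). unfold ray. dot_expand. rewrite Ht, (normal_unit p Hp). ring.
Qed.

(** [F] is negative shortly after [p], as the ray points inward, and positive far away, as the body
    is bounded; the other end is a zero in between. *)
Lemma chord_exists (p v : nat -> R) :
  surf d F p -> unit_tangent p v ->
  exists L, 0 < L /\ surf d F (vadd p (vscale L (ray p v))).
Proof.
  intros Hp Hv. pose proof Hp as [Hpv Hp0]. pose proof sin_delta_gt0 as Hs.
  set (e := ray p v).
  assert (Hev : vec d e) by (apply vec_ray; [exact Hpv|apply Hv]).
  assert (Hx : forall s, vec d (vadd p (vscale s e))) by (intros; auto with vecs).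
  assert (Hd : forall s, is_derive (fun w => F (vadd p (vscale w e))) s
                 << G (vadd p (vscale s e)) , e >>).
  { intros s. apply (is_C1_chain d F G (fun w => vadd p (vscale w e))); auto.
    apply is_vderive_line. }
  assert (E0 : vadd p (vscale 0 e) = p).
  { apply functional_extensionality; intros i. unfold vadd, vscale. ring. }
  assert (Hneg : << G p , e >> < 0).
  { rewrite dot_gradient, (dot_comm d (N p)) by exact Hp. unfold e.
    rewrite ray_dot_normal by assumption.
    pose proof (norm_gt0 _ _ (gradient_gt0 p Hp)). nra. }
  assert (Hin : exists s, 0 < s /\ F (vadd p (vscale s e)) < 0).
  { pose proof (Hd 0) as H0. rewrite E0 in H0.
    assert (Hq : 0 < - << G p , e >>) by lra.
    destruct (proj1 (is_derive_quotient _ _ _) H0 _ Hq) as [eps He].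
    exists (eps / 2). pose proof (cond_pos eps) as Hep. split; [lra|].
    assert (Hh : Rabs ((F (vadd p (vscale (0 + eps / 2) e)) - F (vadd p (vscale 0 e))) / (eps / 2)
                    - << G p , e >>) < - << G p , e >>).
    { apply He; [|lra]. unfold ball; simpl; unfold AbsRing_ball, abs, minus, plus, opp; simpl.
      rewrite Rabs_pos_eq; lra. }
    rewrite E0, Hp0, Rplus_0_l, Rminus_0_r in Hh. apply Rabs_def2 in Hh.
    assert (Hlt : F (vadd p (vscale (eps / 2) e)) / (eps / 2) < 0) by lra.
    apply (Rmult_lt_compat_r (eps / 2)) in Hlt; [|lra].
    unfold Rdiv at 1 in Hlt. rewrite Rmult_assoc, Rinv_l, Rmult_1_r in Hlt by lra. lra. }
  destruct Hin as (s1 & Hs1 & HF1).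
  (* The point at parameter [s] has norm at least [s - norm d p], so this one lies outside the ball
     of radius [Mb]. *)
  set (s2 := s1 + 2 * Rabs Mb + 2 * norm d p + 1).
  assert (HMb : 0 <= Rabs Mb) by apply Rabs_pos. pose proof (norm_ge0 d p) as Hnp.
  assert (Hout : 0 < F (vadd p (vscale s2 e))).
  { destruct (Rlt_le_dec 0 (F (vadd p (vscale s2 e)))) as [Hl|Hl]; [exact Hl|exfalso].
    apply Hbounded in Hl; [|apply Hx].
    assert (Hns : norm d (vadd p (vscale s2 e)) * norm d (vadd p (vscale s2 e)) <= Rabs Mb * Rabs Mb).
    { pose proof (norm_ge0 d (vadd p (vscale s2 e))). pose proof (Rle_abs Mb). nra. }
    rewrite norm_sqr in Hns. revert Hns. dot_expand. unfold e at 3 4.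
    rewrite ray_unit, <- norm_sqr, (dot_comm d e p) by assumption.
    pose proof (cauchy_schwarz d p e) as Hcs. unfold e at 3 4 in Hcs.
    rewrite ray_unit, <- norm_sqr in Hcs by assumption.
    assert (- norm d p <= << p , e >>).
    { destruct (Rle_lt_dec (- norm d p) << p , e >>); [assumption|nra]. }
    intros Hns. unfold s2 in *. nra. }
  destruct (IVT_gen (fun w => F (vadd p (vscale w e))) s1 s2 0) as (L & HL & HFL).
  - intros w. apply continuity_pt_filterlim. eapply is_derive_continuous, Hd.
  - split; [eapply Rle_trans; [apply Rmin_l|lra]|eapply Rle_trans; [|apply Rmax_r]; lra].
  - exists L. rewrite Rmin_left in HL by (unfold s2; lra). split; [lra|]. split; [apply Hx|exact HFL].
Qed.

Lemma asin_eq_delta (x : R) : 0 <= x -> asin x = delta -> x = sin delta.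
Proof.
  intros Hx Ha. destruct (Rle_lt_dec x 1) as [H1|H1].
  - rewrite <- Ha. symmetry. apply sin_asin. lra.
  (* Beyond 1, [asin] is constantly [PI / 2], a value excluded by the bound on [delta]. *)
  - exfalso. revert Ha. unfold asin.
    destruct (Rle_dec x (-1)); [lra|]. destruct (Rle_dec 1 x); lra.
Qed.

Lemma angle_hyp_unit (L : R) (e n : nat -> R) :
  0 < L -> << e , e >> = 1 -> << n , n >> = 1 ->
  angle_hyp d (vscale L e) n = asin (Rabs << e , n >>).
Proof.
  intros HL He Hn. unfold angle_hyp. rewrite dot_vscale_l, (norm_eq1 d n Hn).
  assert (E : norm d (vscale L e) = L).
  { unfold norm. rewrite dot_vscale_l, dot_vscale_r, He, Rmult_1_r. apply sqrt_square. lra. }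
  rewrite E, Rabs_mult, (Rabs_pos_eq L) by lra. f_equal. field. lra.
Qed.

(** The Gutkin property determines the angle at the far end only up to sign, since [angle_hyp] takes
    an absolute value. Convexity settles the sign: the segment stays in [F <= 0], so [F] cannot be
    decreasing on arrival at [q]. *)
Lemma chord_angle (p v : nat -> R) (L : R) :
  surf d F p -> unit_tangent p v -> 0 < L -> surf d F (vadd p (vscale L (ray p v))) ->
  << ray p v , N (vadd p (vscale L (ray p v))) >> = sin delta.
Proof.
  intros Hp Hv HL Hq. set (e := ray p v) in *. set (q := vadd p (vscale L e)) in *.
  pose proof sin_delta_gt0 as Hs.
  assert (He : << e , e >> = 1) by (now apply ray_unit).
  assert (Hqp : vsub q p = vscale L e).
  { apply functional_extensionality; intros i. unfold q, vsub, vadd, vscale. ring. }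
  assert (Hge : 0 <= << e , N q >>).
  { assert (Hd : is_derive (fun t => F (vadd (vscale (1 - t) p) (vscale t q))) 1
             << G q , vsub q p >>).
    { replace (G q) with (G (vadd (vscale (1 - 1) p) (vscale 1 q))).
      - apply (is_C1_chain d F G (fun t => vadd (vscale (1 - t) p) (vscale t q))); [exact HF| |].
        + intros t. destruct Hp as [Hp _], Hq as [Hq _]. auto with vecs.
        + intros i Hi. unfold vadd, vscale, vsub. auto_derive; [exact I|ring].
      - f_equal. apply functional_extensionality; intros i. unfold vadd, vscale. ring. }
    rewrite Hqp, dot_gradient, dot_vscale_r, (dot_comm d (N q)) in Hd by exact Hq.
    set (D := norm d (G q) * (L * << e , N q >>)) in *.
    destruct (Rle_lt_dec 0 << e , N q >>) as [Hr|Hr]; [exact Hr|exfalso].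
    assert (HD : 0 < - D).
    { pose proof (norm_gt0 _ _ (gradient_gt0 q Hq)). unfold D.
      assert (L * << e , N q >> < 0) by nra. nra. }
    destruct (proj1 (is_derive_quotient _ _ _) Hd _ HD) as [eps Hquot].
    pose proof (cond_pos eps) as Hep.
    (* A step back from [q]: at most 1 to stay on the segment, below [eps] to keep the quotient near
       [D]. *)
    set (h := Rmin (eps / 2) 1).
    assert (Hh : 0 < h /\ h <= 1 /\ h < eps).
    { unfold h. pose proof (Rmin_l (eps / 2) 1). pose proof (Rmin_r (eps / 2) 1).
      assert (0 < Rmin (eps / 2) 1) by (apply Rmin_glb_lt; lra). lra. }
    assert (Hb : Rabs ((F (vadd (vscale (1 - (1 + - h)) p) (vscale (1 + - h) q))
                   - F (vadd (vscale (1 - 1) p) (vscale 1 q))) / (- h) - D) < - D).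
    { apply Hquot; [|lra]. unfold ball; simpl; unfold AbsRing_ball, abs, minus, plus, opp; simpl.
      rewrite Rabs_left; lra. }
    replace (vadd (vscale (1 - 1) p) (vscale 1 q)) with q in Hb.
    2:{ apply functional_extensionality; intros i. unfold vadd, vscale. ring. }
    assert (Hin : F (vadd (vscale (1 - (1 + - h)) p) (vscale (1 + - h) q)) <= 0).
    { apply Hconvex; [apply Hp|apply Hq|destruct Hp; lra|destruct Hq; lra|lra]. }
    rewrite (proj2 Hq), Rminus_0_r in Hb. apply Rabs_def2 in Hb. destruct Hb as [Hb _].
    assert (Hlt : F (vadd (vscale (1 - (1 + - h)) p) (vscale (1 + - h) q)) / - h < 0) by lra.
    assert (0 <= F (vadd (vscale (1 - (1 + - h)) p) (vscale (1 + - h) q)) / - h).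
    { replace (F (vadd (vscale (1 - (1 + - h)) p) (vscale (1 + - h) q)) / - h) with
        (- F (vadd (vscale (1 - (1 + - h)) p) (vscale (1 + - h) q)) * / h) by (field; lra).
      apply Rmult_le_pos; [lra|]. left. apply Rinv_0_lt_compat. lra. }
    lra. }
  rewrite <- (Rabs_pos_eq << e , N q >>) by exact Hge.
  apply asin_eq_delta; [apply Rabs_pos|].
  rewrite <- (angle_hyp_unit L e (N q) HL He (normal_unit q Hq)), <- Hqp.
  apply Hgutkin; [exact Hp|exact Hq| |].
  - intros E. rewrite <- E in Hqp.
    assert (E2 : << vscale L e , vscale L e >> = 0) by (rewrite <- Hqp; dot_expand; ring).
    rewrite dot_vscale_l, dot_vscale_r, He in E2. nra.
  - rewrite Hqp, (angle_hyp_unit L e (N p) HL He (normal_unit p Hp)).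
    unfold e. rewrite ray_dot_normal by assumption.
    rewrite Rabs_Ropp, Rabs_pos_eq by lra. apply asin_sin. lra.
Qed.

(** * Differentiable families of chords *)

Lemma is_vderive_ray (x v : R -> nat -> R) (t : R) (x' v' : nat -> R) :
  (forall s, vec d (x s)) -> surf d F (x t) -> is_vderive d x t x' -> is_vderive d v t v' ->
  is_vderive d (fun s => ray (x s) (v s)) t
    (vsub (vscale (cos delta) v') (vscale (sin delta) (shape (x t) x'))).
Proof.
  intros Hx Hs Dx Dv. apply is_vderive_vsub; apply is_vderive_vscale_const; [exact Dv|].
  now apply normal_chain.
Qed.

(** The chord leaves the body transversally, its direction having normal component [sin delta > 0],
    so [implicit_ray] applies. The window around [L1] later bounds [L] away from zero and from
    above. *)
Lemma chord_family (x v : R -> nat -> R) (t1 r L1 : R) :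
  (forall s, vec d (x s)) -> (forall s, vec d (v s)) -> 0 < r ->
  (forall s, Rabs (s - t1) < r ->
     surf d F (x s) /\ unit_tangent (x s) (v s) /\ ex_vderive d x s /\ ex_vderive d v s) ->
  0 < L1 -> surf d F (vadd (x t1) (vscale L1 (ray (x t1) (v t1)))) ->
  exists eps L L', 0 < eps /\ eps <= r /\ L t1 = L1 /\
    forall s, Rabs (s - t1) < eps ->
      L1 / 2 < L s < 2 * L1 /\ surf d F (vadd (x s) (vscale (L s) (ray (x s) (v s)))) /\
      is_derive L s (L' s).
Proof.
  intros Hx Hv Hr Hnear HL1 Hq.
  assert (Ht1 : Rabs (t1 - t1) < r) by (rewrite Rminus_diag, Rabs_R0; exact Hr).
  destruct (Hnear t1 Ht1) as (Hst & Hut & _).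
  assert (Hvr : forall s, vec d (ray (x s) (v s))) by (intros; apply vec_ray; auto).
  destruct (implicit_ray d F G x (fun s => ray (x s) (v s)) t1 L1 r (L1 / 2))
    as (eps & L & L' & He & Her & HL & Hall); try assumption.
  - intros s Hs. destruct (Hnear s Hs) as (Hs1 & _ & [x' Hx'] & [v' Hv']).
    split; [now exists x'|]. eexists. apply (is_vderive_ray x v s x' v'); assumption.
  - apply Hq.
  - rewrite dot_gradient, dot_comm by exact Hq. rewrite chord_angle by assumption.
    apply Rmult_lt_0_compat; [apply norm_gt0, gradient_gt0, Hq|apply sin_delta_gt0].
  - lra.
  - exists eps, L, L'. repeat (split; [assumption|]). intros s Hs.
    destruct (Hall s Hs) as (Ha & Hb & Hc). apply Rabs_def2 in Ha.
    split; [lra|]. split; [|exact Hc]. split; [auto with vecs|exact Hb].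
Qed.

(* The identity expresses that the billiard map preserves the canonical symplectic
   form: [X] and [Y] are two infinitesimal variations of a chord. *)
Lemma chord_symplectic (e Xp Xe SpX SqX Yp Ye SpY SqY : nat -> R) (L XL YL s : R) :
  << Xe , e >> = 0 -> << Ye , e >> = 0 -> << SpX , Yp >> = << SpY , Xp >> ->
  << SqX , vadd Yp (vadd (vscale YL e) (vscale L Ye)) >> =
  << SqY , vadd Xp (vadd (vscale XL e) (vscale L Xe)) >> ->
  << vadd Xe (vscale s SpX) , Yp >> = 0 -> << vadd Ye (vscale s SpY) , Xp >> = 0 ->
  << vsub Xe (vscale s SqX) , vadd Yp (vadd (vscale YL e) (vscale L Ye)) >> =
  << vsub Ye (vscale s SqY) , vadd Xp (vadd (vscale XL e) (vscale L Xe)) >>.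
Proof.
  intros H1 H2 H3 H4 H5 H6.
  rewrite (dot_vsub_l d Xe), (dot_vsub_l d Ye), !(dot_vscale_l d s), H4.
  revert H5 H6. dot_expand. rewrite H1, H2, H3, (dot_comm d Ye Xe). intros H5 H6. lra.
Qed.

(** Vectors built with [shape] may be non-zero at indices [>= d], where [H] is unconstrained;
    truncation changes no dot product. *)
Lemma exists_vec_eq (x : nat -> R) :
  exists x', vec d x' /\ forall i, (i < d)%nat -> x' i = x i.
Proof.
  exists (fun i => if Nat.ltb i d then x i else 0). split; intros i Hi;
    destruct (Nat.ltb_spec i d); try lia; reflexivity.
Qed.

Lemma dot_eq0_of_self (x y : nat -> R) : << x , x >> = 0 -> << x , y >> = 0.
Proof. intros Hx. pose proof (cauchy_schwarz d x y) as Hc. rewrite Hx in Hc. nra. Qed.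

(** * First variation of one chord along a geodesic *)

Section Chord.

Variables (p v : nat -> R) (L rho k XL : R).
Hypothesis Hp : surf d F p.
Hypothesis Hv : unit_tangent p v.
Hypothesis HL : 0 < L.
Let e := ray p v.
Let q := vadd p (vscale L e).
Hypothesis Hq : surf d F q.
Let u := vscale (/ cos delta) (vsub e (vscale (sin delta) (N q))).
Hypothesis Hk : k = - << shape p (vscale rho v) , v >>.
(** [Xe] and [Xq] are the velocities of the chord direction and of its far end when [p] moves along
    a geodesic with velocity [rho v], the unit tangent having derivative [k N]; [XL] is the rate of
    change of the length. *)
Let Xe := vsub (vscale (cos delta * k) (N p)) (vscale (sin delta) (shape p (vscale rho v))).
Let Xq := vadd (vscale rho v) (vadd (vscale XL e) (vscale L Xe)).
Hypothesis HXq : << N q , Xq >> = 0.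

Lemma chord_end_angle : << e , N q >> = sin delta.
Proof. now apply chord_angle. Qed.

Lemma chord_dir_unit : << e , e >> = 1.
Proof. now apply ray_unit. Qed.

Lemma chord_end_tangent : unit_tangent q u.
Proof.
  pose proof cos_delta_gt0 as Hc. pose proof sin2_cos2_delta as Hsc.
  pose proof chord_end_angle as He. pose proof chord_dir_unit as H1.
  pose proof (normal_unit q Hq) as Hn.
  assert (Hev : vec d e) by (apply vec_ray; [apply Hp|apply Hv]).
  split; [|split].
  - unfold u. pose proof (vec_normal q (proj1 Hq)). auto with vecs.
  - unfold u. dot_expand. rewrite (dot_comm d (N q) e), He, H1, Hn.
    transitivity (/ cos delta * / cos delta * (1 - sin delta * sin delta)); [ring|].
    replace (1 - sin delta * sin delta) with (cos delta * cos delta) by lra. field. lra.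
  - unfold u. dot_expand. rewrite He, Hn. ring.
Qed.

(** The reversed chord is a chord of the same kind issuing from [q], so [chord_exists]-type results
    apply to it; this carries variations prescribed at [q] back to [p]. *)
Lemma ray_chord_end : ray q (vscale (-1) u) = vscale (-1) e.
Proof.
  pose proof cos_delta_gt0 as Hc. apply functional_extensionality; intros i.
  unfold ray, u, vsub, vscale. field. lra.
Qed.

Lemma chord_dir_dot : << Xe , e >> = 0.
Proof.
  pose proof Hv as (_ & Hv1 & Hv2).
  unfold Xe, e, ray. dot_expand. rewrite (dot_comm d (N p) v), Hv2.
  rewrite (normal_unit p Hp), (shape_dot_normal p _ Hp), Hk. ring.
Qed.

(** A variation of unit tangent vectors at [q] is pulled back to [p] along reversed chords and
    paired with the geodesic variation. The latter is characteristic, so the symplectic form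
    vanishes on the pair at [p], and the identity is its vanishing at [q]. *)
Lemma variation_identity (qs us : R -> nat -> R) (r : R) (q1 u1 : nat -> R) :
  (forall s, vec d (qs s)) -> (forall s, vec d (us s)) -> 0 < r ->
  (forall s, Rabs (s - 0) < r -> surf d F (qs s) /\ unit_tangent (qs s) (us s) /\
     ex_vderive d qs s /\ ex_vderive d us s) ->
  qs 0 = q -> us 0 = u -> is_vderive d qs 0 q1 -> is_vderive d us 0 u1 ->
  << vsub Xe (vscale (sin delta) (shape q Xq)) , q1 >> = cos delta * << u1 , Xq >>.
Proof.
  intros Hvq Hvu Hr Hnear Eq Eu Dq Du.
  set (es := fun s => ray (qs s) (vscale (-1) (us s))).
  assert (Hes0 : es 0 = vscale (-1) e) by (unfold es; rewrite Eq, Eu; apply ray_chord_end).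
  assert (Hp0 : vadd (qs 0) (vscale L (es 0)) = p).
  { rewrite Hes0, Eq. apply functional_extensionality; intros i.
    unfold q, vadd, vscale. ring. }
  assert (Hut : forall s, Rabs (s - 0) < r -> unit_tangent (qs s) (vscale (-1) (us s))).
  { intros s Hs. destruct (Hnear s Hs) as (_ & (Ha & Hb & Hc) & _).
    split; [auto with vecs|]. dot_expand. rewrite Hb, Hc. split; ring. }
  destruct (chord_family qs (fun s => vscale (-1) (us s)) 0 r L)
    as (eps & Ls & Ls' & He & Her & HLs & Hall); try assumption.
  { auto with vecs. }
  { intros s Hs. destruct (Hnear s Hs) as (Ha & _ & Hb & [w Hc]).
    split; [exact Ha|]. split; [now apply Hut|]. split; [exact Hb|].
    eexists. apply is_vderive_vscale_const, Hc. }
  { fold (es 0). now rewrite Hp0. }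
  set (ps := fun s => vadd (qs s) (vscale (Ls s) (es s))).
  assert (Hps0 : ps 0 = p) by (unfold ps; now rewrite HLs).
  assert (Hball : locally 0 (fun s => Rabs (s - 0) < eps)).
  { generalize (continuous_near R_UniformSpace (fun w => w) 0 _ (continuous_id 0) He).
    apply filter_imp. auto. }
  assert (Hz : Rabs (0 - 0) < eps) by (rewrite Rminus_diag, Rabs_R0; exact He).
  assert (Hves : forall s, vec d (es s)) by (intros; unfold es; apply vec_ray; auto with vecs).
  assert (Hvps : forall s, vec d (ps s)) by (intros; unfold ps; auto with vecs).
  set (Ez := vsub (vscale (cos delta) (vscale (-1) u1)) (vscale (sin delta) (shape q q1))).
  assert (Des : is_vderive d es 0 Ez).
  { unfold Ez. rewrite <- Eq. apply is_vderive_ray; [exact Hvq| |exact Dq|].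
    - rewrite Eq; exact Hq.
    - apply is_vderive_vscale_const, Du. }
  set (Yp := vadd q1 (vadd (vscale (Ls' 0) (vscale (-1) e)) (vscale L Ez))).
  assert (Dps : is_vderive d ps 0 Yp).
  { unfold Yp. rewrite <- Hes0, <- HLs. apply is_vderive_vadd; [exact Dq|].
    apply is_vderive_vscale; [apply (Hall 0 Hz)|exact Des]. }
  assert (HNp : << N p , Yp >> = 0).
  { rewrite <- Hps0. apply surface_curve_tangent; [exact Hvps|exact Dps|].
    revert Hball. apply filter_imp. intros s Hs. apply (Hall s Hs). }
  assert (HNq : << N q , q1 >> = 0).
  { rewrite <- Eq. apply surface_curve_tangent; [exact Hvq|exact Dq|].
    revert Hball. apply filter_imp. intros s Hs. apply Hnear. lra. }
  assert (HEe : << Ez , e >> = 0).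
  { pose proof (is_derive_dot d _ _ 0 _ _ Des Des) as Hd.
    apply (is_derive_loc_const _ _ _ 1) in Hd.
    - revert Hd. rewrite Hes0. dot_expand. rewrite (dot_comm d e Ez). lra.
    - revert Hball. apply filter_imp. intros s Hs. apply ray_unit; [apply Hnear|apply Hut]; lra. }
  (* The reversed chords also arrive at angle [delta]; differentiating this says that the
     pulled-back tangent vectors keep their length. *)
  assert (HEN : << Ez , N p >> = << e , shape p Yp >>).
  { assert (DN : is_vderive d (fun s => N (ps s)) 0 (shape p Yp)).
    { rewrite <- Hps0 at 1. apply normal_chain; [exact Hvps|exact Dps|]. rewrite Hps0; exact Hp. }
    pose proof (is_derive_dot d _ _ 0 _ _ Des DN) as Hd.
    apply (is_derive_loc_const _ _ _ (sin delta)) in Hd.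
    - revert Hd. rewrite Hes0, Hps0. dot_expand. lra.
    - revert Hball. apply filter_imp. intros s Hs.
      destruct (Hall s Hs) as ((Ha & _) & Hb & _).
      apply chord_angle; [apply Hnear; lra|apply Hut; lra|lra|exact Hb]. }
  assert (Hnv : << N p , vscale rho v >> = 0).
  { dot_expand. rewrite (dot_comm d (N p)). destruct Hv as (_ & _ & ->). ring. }
  assert (EYq : vadd Yp (vadd (vscale (Ls' 0) e) (vscale L (vscale (-1) Ez))) = q1).
  { apply functional_extensionality; intros i. unfold Yp, vadd, vscale. ring. }
  pose proof (chord_symplectic e (vscale rho v) Xe (shape p (vscale rho v)) (shape q Xq)
    Yp (vscale (-1) Ez) (shape p Yp) (shape q q1) L XL (Ls' 0) (sin delta)) as HS.
  fold Xq in HS. rewrite EYq in HS. rewrite HS.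
  - transitivity << vscale (cos delta) u1 , Xq >>; [|now rewrite dot_vscale_l].
    apply dot_ext; [|reflexivity]. intros i _. unfold Ez, vsub, vscale. ring.
  - exact chord_dir_dot.
  - dot_expand. rewrite HEe. ring.
  - now apply shape_symmetric.
  - now apply shape_symmetric.
  (* A geodesic has normal acceleration, so only a multiple of [N p] is left to pair with a tangent
     vector. *)
  - unfold Xe. dot_expand. rewrite HNp. ring.
  (* With [v] written through [e] and [N p], this is the orthogonality of [v] to the variation of
     the pulled-back unit tangent vectors. *)
  - pose proof cos_delta_gt0 as Hc.
    assert (Ev : v = vscale (/ cos delta) (vadd e (vscale (sin delta) (N p)))).
    { apply functional_extensionality; intros i. unfold e, ray, vadd, vsub, vscale. field. lra. }
    rewrite Ev. dot_expand. rewrite HEe, HEN, (shape_dot_normal p _ Hp), (dot_comm d e). ring.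
Qed.

(** Turning [u] in the tangent space at the fixed point [q] shows that [Xq] has no component
    orthogonal to [u]. Pairing with every [y] expresses equality of vectors up to the coordinates
    beyond [d]. *)
Lemma chord_end_velocity (y : nat -> R) : << Xq , y >> = << Xq , u >> * << u , y >>.
Proof.
  destruct chord_end_tangent as (Huv & Hu1 & Hu2).
  pose proof cos_delta_gt0 as Hc.
  destruct (exists_vec_eq (vsub Xq (vscale << Xq , u >> u))) as (z & Hzv & Hz).
  assert (Hzd : forall w, << z , w >> = << Xq , w >> - << Xq , u >> * << u , w >>).
  { intros w. rewrite (dot_ext d z w _ w Hz (fun _ _ => eq_refl)). dot_expand. ring. }
  enough (H0 : << z , z >> = 0).
  { apply (dot_eq0_of_self _ y) in H0. rewrite Hzd in H0. lra. }
  destruct (dot_self_ge0 d z) as [Hpos|Hz0]; [|easy]. exfalso.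
  pose proof (norm_gt0 d z Hpos) as Hn. pose proof (norm_sqr d z) as Hsq.
  (* If the component [z] of [Xq] orthogonal to [u] were non-zero, rotating [u] towards its
     direction [w] would turn the variation identity into [0 = cos delta * norm d z]. *)
  set (w := vscale (/ norm d z) z).
  assert (Hw1 : << w , w >> = 1).
  { unfold w. dot_expand. rewrite <- Hsq. field. lra. }
  assert (Hwu : << u , w >> = 0).
  { unfold w. dot_expand. rewrite dot_comm, Hzd, Hu1. ring. }
  assert (HwN : << w , N q >> = 0).
  { unfold w. dot_expand. rewrite Hzd, (dot_comm d Xq (N q)), HXq, Hu2. ring. }
  set (us := fun s => vadd (vscale (cos s) u) (vscale (sin s) w)).
  assert (Hwv : vec d w) by (unfold w; auto with vecs).
  assert (Dus : forall s, is_vderive d us s (vadd (vscale (- sin s) u) (vscale (cos s) w))).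
  { intros s i Hi. unfold us, vadd, vscale. auto_derive; [exact I|ring]. }
  pose proof (variation_identity (fun _ => q) us 1 (fun _ => 0)
                (vadd (vscale (- sin 0) u) (vscale (cos 0) w))) as Hid.
  rewrite dot_0_r in Hid.
  assert (Hwq : << w , Xq >> = norm d z).
  { unfold w. dot_expand. apply (Rmult_eq_reg_l (norm d z)); [|lra].
    rewrite Hsq, <- Rmult_assoc, Rinv_r, Rmult_1_l by lra.
    rewrite (Hzd z), (dot_comm d u z), (Hzd u), Hu1, (dot_comm d z). ring. }
  revert Hid. dot_expand. rewrite sin_0, cos_0, Hwq. intros Hid.
  enough (0 = cos delta * (- 0 * << u , Xq >> + 1 * norm d z)) by nra.
  apply Hid; try easy.
  - intros _; apply Hq.
  - intros s. unfold us. auto with vecs.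
  - lra.
  - intros s _. split; [exact Hq|]. split; [|split].
    + split; [unfold us; auto with vecs|]. unfold us. dot_expand.
      rewrite (dot_comm d w u), Hu1, Hu2, Hw1, Hwu, HwN.
      split; [|ring]. pose proof (sin2_cos2 s) as Hsc. unfold Rsqr in Hsc. lra.
    + exists (fun _ => 0). apply is_vderive_const.
    + eexists. apply Dus.
  - unfold us. rewrite cos_0, sin_0. apply functional_extensionality; intros i.
    unfold vadd, vscale. ring.
  - apply is_vderive_const.
  - apply (is_vderive_eq d _ _ _ _ (Dus 0)). intros i _. now rewrite sin_0, cos_0.
Qed.

(** Move [q] in the direction [y], carrying [u] along as a unit tangent vector. The derivative of
    the latter is orthogonal to [u], hence to [Xq], and the right side of [variation_identity]
    vanishes. *)
Lemma chord_end_acceleration_tangent (y : nat -> R) :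
  vec d y -> << N q , y >> = 0 ->
  << vsub Xe (vscale (sin delta) (shape q Xq)) , y >> = 0.
Proof.
  intros Hy HNy. pose proof Hq as [Hqv _].
  destruct chord_end_tangent as (Huv & Hu1 & Hu2).
  pose proof (vec_normal q Hqv) as HNv.
  assert (E0 : vadd q (vscale 0 y) = q).
  { apply functional_extensionality; intros i. unfold vadd, vscale. ring. }
  assert (E1 : vadd (vadd q (vscale 0 y)) (vscale 0 (N q)) = q).
  { apply functional_extensionality; intros i. unfold vadd, vscale. ring. }
  (* A curve on the table with initial velocity [y]: the points [q + s y] are pushed along the fixed
     direction [N q] onto the surface. *)
  destruct (implicit_ray d F G (fun s => vadd q (vscale s y)) (fun _ => N q) 0 0 1 1)
    as (eps & tau & tau' & He & _ & Htau & Hall); try lra; try assumption.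
  { intros; auto with vecs. }
  { intros; exact HNv. }
  { intros s _. split; eexists; [apply is_vderive_line|apply is_vderive_const]. }
  { rewrite E1. apply Hq. }
  { rewrite E1, dot_gradient, normal_unit, Rmult_1_r by exact Hq.
    apply norm_gt0, gradient_gt0, Hq. }
  set (qs := fun s => vadd (vadd q (vscale s y)) (vscale (tau s) (N q))).
  assert (Hqs0 : qs 0 = q) by (unfold qs; now rewrite Htau).
  assert (Hvqs : forall s, vec d (qs s)) by (intros; unfold qs; auto with vecs).
  assert (Hsqs : forall s, Rabs (s - 0) < eps -> surf d F (qs s)).
  { intros s Hs. split; [apply Hvqs|apply Hall, Hs]. }
  assert (Dqs : forall s, Rabs (s - 0) < eps ->
            is_vderive d qs s (vadd y (vscale (tau' s) (N q)))).
  { intros s Hs. apply is_vderive_vadd; [apply is_vderive_line|].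
    intros i Hi. unfold vscale. eapply is_derive_eq.
    - apply (is_derive_Rmult tau (fun _ => N q i)); [apply Hall, Hs|apply is_derive_Rconst].
    - ring. }
  (* Projection of [u] to the moving tangent space; it starts with length 1, so it can be normalized
     nearby. *)
  set (ws := fun s => vsub u (vscale << u , N (qs s) >> (N (qs s)))).
  assert (Hws0 : ws 0 = u).
  { unfold ws. rewrite Hqs0, Hu2. apply functional_extensionality; intros i.
    unfold vsub, vscale. ring. }
  assert (Hvws : forall s, vec d (ws s)).
  { intros s. pose proof (vec_normal _ (Hvqs s)). unfold ws. auto with vecs. }
  assert (Dws : forall s, Rabs (s - 0) < eps -> ex_vderive d ws s).
  { intros s Hs. eexists. apply is_vderive_vsub; [apply is_vderive_const|].
    assert (DN := normal_chain qs s _ Hvqs (Dqs s Hs) (Hsqs s Hs)).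
    apply is_vderive_vscale; [|exact DN].
    apply (is_derive_ext (fun w => << N (qs w) , u >>)); [intros; apply dot_comm|].
    apply is_derive_dot_const, DN. }
  assert (Hz : Rabs (0 - 0) < eps) by (rewrite Rminus_diag, Rabs_R0; exact He).
  assert (Hpos : exists r, 0 < r /\ r <= eps /\ forall s, Rabs (s - 0) < r -> 0 < << ws s , ws s >>).
  { destruct (Dws 0 Hz) as [w' Hw'].
    destruct (continuous_near R_UniformSpace _ 0 _
      (is_derive_continuous _ _ _ (is_derive_dot d _ _ 0 _ _ Hw' Hw')) Rlt_0_1) as [r Hr].
    exists (Rmin eps r). pose proof (Rmin_l eps r). pose proof (Rmin_r eps r).
    split; [apply Rmin_glb_lt; [lra|apply cond_pos]|]. split; [lra|].
    intros s Hs. assert (Hb : Rabs (<< ws s , ws s >> - << ws 0 , ws 0 >>) < 1).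
    { apply Hr. unfold ball; simpl; unfold AbsRing_ball, abs, minus, plus, opp; simpl.
      fold (s - 0). lra. }
    rewrite Hws0, Hu1 in Hb. apply Rabs_def2 in Hb. lra. }
  destruct Hpos as (r & Hr & Hre & Hpos).
  set (us := fun s => vscale (/ norm d (ws s)) (ws s)).
  assert (Dus : forall s, Rabs (s - 0) < r -> ex_vderive d us s).
  { intros s Hs. destruct (Dws s) as [w' Hw']; [lra|].
    destruct (is_vderive_normalize d ws s w' (Hpos s Hs) Hw') as [a Ha]. eexists. exact Ha. }
  assert (Hut : forall s, Rabs (s - 0) < r -> unit_tangent (qs s) (us s)).
  { intros s Hs. pose proof (norm_gt0 _ _ (Hpos s Hs)) as Hn.
    split; [unfold us; auto with vecs|]. split.
    - unfold us. dot_expand. rewrite <- norm_sqr. field. lra.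
    - unfold us, ws. dot_expand. rewrite (normal_unit (qs s)) by (apply Hsqs; lra). ring. }
  assert (Hzr : Rabs (0 - 0) < r) by (rewrite Rminus_diag, Rabs_R0; exact Hr).
  destruct (Dus 0 Hzr) as [u1 Hu1'].
  assert (Hus0 : us 0 = u).
  { unfold us. rewrite Hws0, (norm_eq1 d u Hu1). apply functional_extensionality; intros i.
    unfold vscale. field. }
  assert (Hball : locally 0 (fun s => Rabs (s - 0) < r)).
  { generalize (continuous_near R_UniformSpace (fun w => w) 0 _ (continuous_id 0) Hr).
    apply filter_imp. auto. }
  assert (Huu : << u , u1 >> = 0).
  { pose proof (is_derive_dot d _ _ 0 _ _ Hu1' Hu1') as Hd.
    apply (is_derive_loc_const _ _ _ 1) in Hd.
    - rewrite Hus0, (dot_comm d u1) in Hd. lra.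
    - revert Hball. apply filter_imp. intros s Hs. apply Hut, Hs. }
  assert (Htau' : tau' 0 = 0).
  { assert (HNt : << N (qs 0) , vadd y (vscale (tau' 0) (N q)) >> = 0).
    { apply surface_curve_tangent; [exact Hvqs|apply Dqs, Hz|].
      revert Hball. apply filter_imp. intros s Hs. apply Hsqs. lra. }
    revert HNt. rewrite Hqs0. dot_expand. rewrite HNy, (normal_unit q Hq). lra. }
  rewrite (dot_ext d _ y (vsub Xe (vscale (sin delta) (shape q Xq)))
             (vadd y (vscale (tau' 0) (N q)))); [|reflexivity|].
  2:{ intros i _. rewrite Htau'. unfold vadd, vscale. ring. }
  rewrite (variation_identity qs us r _ u1); try assumption.
  - rewrite (dot_comm d u1), chord_end_velocity, Huu. ring.
  - intros s. unfold us. auto with vecs.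
  - intros s Hs. split; [apply Hsqs; lra|]. split; [now apply Hut|].
    split; [eexists; apply Dqs; lra|now apply Dus].
  - apply Dqs, Hz.
Qed.

(** [Xe] minus [sin delta] times the derivative of the normal is [cos delta] times the derivative of
    [u]. Orthogonal to the tangent space, it is normal, and pairing with [N q], where the shape term
    drops out, gives the coefficient. *)
Lemma chord_end_acceleration (y : nat -> R) :
  << Xe , y >> = sin delta * << shape q Xq , y >> + << Xe , N q >> * << N q , y >>.
Proof.
  destruct (exists_vec_eq (vsub y (vscale << N q , y >> (N q)))) as (z & Hzv & Hz).
  assert (Hzd : forall w, << w , z >> = << w , y >> - << N q , y >> * << w , N q >>).
  { intros w. rewrite (dot_ext d w z w _ (fun _ _ => eq_refl) Hz). dot_expand. ring. }
  assert (H0 : << N q , z >> = 0) by (rewrite Hzd, (normal_unit q Hq); ring).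
  pose proof (chord_end_acceleration_tangent z Hzv H0) as Ha.
  rewrite Hzd in Ha. revert Ha. dot_expand. rewrite (shape_dot_normal q _ Hq). lra.
Qed.

End Chord.
Lemma dot_unit_bound (x y : nat -> R) (B : R) :
  0 <= B -> << x , x >> <= B * B -> << y , y >> = 1 -> Rabs << x , y >> <= B.
Proof.
  intros HB Hx Hy. pose proof (cauchy_schwarz d x y) as Hc. rewrite Hy in Hc.
  rewrite <- (Rabs_pos_eq B HB). apply Rsqr_le_abs_0. unfold Rsqr. lra.
Qed.

Lemma dot_unit_le1 (x y : nat -> R) :
  << x , x >> = 1 -> << y , y >> = 1 -> Rabs << x , y >> <= 1.
Proof. intros Hx Hy. apply dot_unit_bound; lra. Qed.

(** The hypothesis, applied to the remainder [z] of [x] after projection to the plane, yields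
    [dot d z z = 0]. It converts orthogonality statements into coordinates. *)
Lemma plane_decomposition (v n x : nat -> R) :
  vec d v -> vec d n -> << v , v >> = 1 -> << n , n >> = 1 -> << v , n >> = 0 ->
  (forall y, << v , y >> = 0 -> << n , y >> = 0 -> << x , y >> = 0) ->
  forall w, << x , w >> = << x , v >> * << v , w >> + << x , n >> * << n , w >>.
Proof.
  intros Hvv Hnv Hv Hn Hvn Hx w.
  set (z := vsub x (vadd (vscale << x , v >> v) (vscale << x , n >> n))).
  assert (Hzv : << v , z >> = 0).
  { unfold z. dot_expand. rewrite Hv, Hvn, (dot_comm d v x). ring. }
  assert (Hzn : << n , z >> = 0).
  { unfold z. dot_expand. rewrite Hn, (dot_comm d n v), Hvn, (dot_comm d n x). ring. }
  pose proof (Hx z Hzv Hzn) as Hxz.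
  assert (Hzz : << z , z >> = 0).
  { unfold z at 1. dot_expand. rewrite Hxz, Hzv, Hzn. ring. }
  apply (dot_eq0_of_self z w) in Hzz. revert Hzz. unfold z. dot_expand. lra.
Qed.

(** ** Transport of a geodesic along its chords *)

Section Geodesic.

Variables (p v : R -> nat -> R) (k : R -> R) (rho a b : R).
Hypothesis Hvp : forall s, vec d (p s).
Hypothesis Hvv : forall s, vec d (v s).
Hypothesis Hrho : 0 < rho.
Hypothesis Hgeo : forall t, a < t < b ->
  surf d F (p t) /\ unit_tangent (p t) (v t) /\
  is_vderive d p t (vscale rho (v t)) /\ is_vderive d v t (vscale (k t) (N (p t))).

(** Tangency and non-vanishing of [v t], the other clauses of [shape_eigen], are already part of
    [Hgeo]. *)
Definition principal_at (t : R) : Prop :=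
  exists lam, forall i, (i < d)%nat -> shape (p t) (v t) i = lam * v t i.

Lemma interval_ball (t : R) : a < t < b ->
  exists r, 0 < r /\ forall s, Rabs (s - t) < r -> a < s < b.
Proof.
  intros Ht. exists (Rmin (t - a) (b - t)). split; [apply Rmin_glb_lt; lra|].
  intros s Hs. pose proof (Rmin_l (t - a) (b - t)). pose proof (Rmin_r (t - a) (b - t)).
  apply Rabs_def2 in Hs. lra.
Qed.

(** Obtained by differentiating the tangency of [v]. It makes [k] locally bounded, although no
    continuity of [k] is assumed. *)
Lemma geodesic_curvature (t : R) : a < t < b ->
  k t = - << shape (p t) (vscale rho (v t)) , v t >>.
Proof.
  intros Ht. destruct (Hgeo t Ht) as (Hs & _ & Dp & Dv).
  pose proof (is_derive_dot d _ _ t _ _ Dv (normal_chain p t _ Hvp Dp Hs)) as Hd.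
  apply (is_derive_loc_const _ _ _ 0) in Hd.
  - revert Hd. dot_expand. rewrite (normal_unit _ Hs), (dot_comm d (v t)). lra.
  - destruct (interval_ball t Ht) as (r & Hr & Hin).
    generalize (continuous_near R_UniformSpace (fun w => w) t _ (continuous_id t) Hr).
    apply filter_imp. intros s Hs'. apply (Hgeo s (Hin s Hs')).
Qed.

Lemma shape_speed_bounded (t1 : R) : a < t1 < b ->
  exists B, 0 <= B /\ locally t1 (fun t =>
    << shape (p t) (vscale rho (v t)) , shape (p t) (vscale rho (v t)) >> <= B * B).
Proof.
  intros Ht1. destruct (Hgeo t1 Ht1) as (Hs & _ & Dp & Dv).
  assert (Cp : forall i, (i < d)%nat -> continuous (fun t => p t i) t1).
  { intros i Hi. eapply is_derive_continuous, Dp, Hi. }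
  assert (CG : forall i, (i < d)%nat -> continuous (fun t => G (p t) i) t1).
  { intros i Hi. apply (continuous_Rd_comp R_UniformSpace d (fun x => G x i)); auto.
    apply (proj2 HF), Hi. }
  assert (CN : forall i, (i < d)%nat -> continuous (fun t => N (p t) i) t1).
  { intros i Hi. eapply is_derive_continuous.
    apply (normal_chain p t1 _ Hvp Dp Hs i Hi). }
  assert (Csh : forall i, (i < d)%nat ->
            continuous (fun t => scaled_hessian (p t) (vscale rho (v t)) i) t1).
  { intros i Hi. unfold scaled_hessian, vscale at 1. apply continuous_Rmult.
    - apply continuous_Rinv_comp.
      + unfold norm. apply continuous_sqrt_comp. now apply continuous_dot.
      + apply Rgt_not_eq, norm_gt0, gradient_gt0, Hs.
    - apply continuous_dot; intros j Hj.
      + apply (continuous_Rd_comp R_UniformSpace d (fun x => H x i j)); auto.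
        apply (proj2 (HG i Hi)), Hj.
      + unfold vscale. apply continuous_Rmult; [apply continuous_const|].
        eapply is_derive_continuous, Dv, Hj. }
  assert (Cs : forall i, (i < d)%nat ->
            continuous (fun t => shape (p t) (vscale rho (v t)) i) t1).
  { intros i Hi. unfold shape, vsub. apply continuous_Rminus; [auto|].
    unfold vscale at 1. apply continuous_Rmult; [|auto]. now apply continuous_dot. }
  assert (Cd := continuous_dot R_UniformSpace d _ _ t1 Cs Cs).
  set (f := fun t => << shape (p t) (vscale rho (v t)) , shape (p t) (vscale rho (v t)) >>) in Cd.
  assert (Hf : 0 <= f t1) by apply dot_self_ge0.
  (* This number is at least 1, so its square dominates it, and it dominates [f] near [t1]. *)
  exists (f t1 + 1). split; [lra|].
  generalize (continuous_near R_UniformSpace f t1 1 Cd Rlt_0_1).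
  apply filter_imp. intros t Ht. apply Rabs_def2 in Ht. fold (f t). nra.
Qed.

(** * The closed linear system on a neighbourhood of one time *)

Section Transport.

Variables (t1 r B L1 : R) (L L' : R -> R).
Hypothesis Hin : forall s, Rabs (s - t1) < r -> a < s < b.
Hypothesis HB : 0 <= B.
Hypothesis HL1 : 0 < L1.
Hypothesis HLs : forall s, Rabs (s - t1) < r ->
  L1 / 2 < L s < 2 * L1 /\ surf d F (vadd (p s) (vscale (L s) (ray (p s) (v s)))) /\
  is_derive L s (L' s).
Hypothesis HSB : forall t, Rabs (t - t1) < r ->
  << shape (p t) (vscale rho (v t)) , shape (p t) (vscale rho (v t)) >> <= B * B.

Let e (t : R) := ray (p t) (v t).
Let q (t : R) := vadd (p t) (vscale (L t) (e t)).
Let M (t : R) := N (q t).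
Let u (t : R) := vscale (/ cos delta) (vsub (e t) (vscale (sin delta) (M t))).
Let S (t : R) := shape (p t) (vscale rho (v t)).
Let e' (t : R) := vsub (vscale (cos delta * k t) (N (p t))) (vscale (sin delta) (S t)).
Let q' (t : R) := vadd (vscale rho (v t)) (vadd (vscale (L' t) (e t)) (vscale (L t) (e' t))).

Lemma locally_ball (t : R) (P : R -> Prop) :
  Rabs (t - t1) < r -> (forall s, Rabs (s - t1) < r -> P s) -> locally t P.
Proof.
  intros Ht HP. assert (Hg : 0 < r - Rabs (t - t1)) by lra.
  generalize (continuous_near R_UniformSpace (fun w => w) t _ (continuous_id t) Hg).
  apply filter_imp. intros s Hs. apply HP.
  replace (s - t1) with ((s - t) + (t - t1)) by ring.
  eapply Rle_lt_trans; [apply Rabs_triang|lra].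
Qed.

Lemma vec_chord_end (t : R) : vec d (q t).
Proof. unfold q, e. pose proof (vec_ray _ _ (Hvp t) (Hvv t)). pose proof (Hvp t). auto with vecs. Qed.

Lemma chord_dir_derive (t : R) : Rabs (t - t1) < r -> is_vderive d e t (e' t).
Proof.
  intros Ht. destruct (Hgeo t (Hin t Ht)) as (Hs & _ & Dp & Dv).
  eapply is_vderive_eq; [apply (is_vderive_ray p v t _ _ Hvp Hs Dp Dv)|].
  intros i _. unfold e', S, vsub, vscale. ring.
Qed.

Lemma chord_end_derive (t : R) : Rabs (t - t1) < r -> is_vderive d q t (q' t).
Proof.
  intros Ht. destruct (Hgeo t (Hin t Ht)) as (_ & _ & Dp & _).
  apply is_vderive_vadd; [exact Dp|].
  apply is_vderive_vscale; [apply HLs, Ht|now apply chord_dir_derive].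
Qed.

Lemma chord_end_derive_tangent (t : R) : Rabs (t - t1) < r -> << M t , q' t >> = 0.
Proof.
  intros Ht. apply surface_curve_tangent; [apply vec_chord_end|now apply chord_end_derive|].
  apply (locally_ball t _ Ht). intros s Hs. apply HLs, Hs.
Qed.

Lemma transport_velocity (t : R) (y : nat -> R) : Rabs (t - t1) < r ->
  << q' t , y >> = << q' t , u t >> * << u t , y >>.
Proof.
  intros Ht. destruct (Hgeo t (Hin t Ht)) as (Hs & Hut & _).
  destruct (HLs t Ht) as (HLt & Hq & _).
  apply (chord_end_velocity (p t) (v t) (L t) rho (k t) (L' t)); try assumption.
  - lra.
  - apply geodesic_curvature, Hin, Ht.
  - now apply chord_end_derive_tangent.
Qed.

Lemma transport_acceleration (t : R) (y : nat -> R) : Rabs (t - t1) < r ->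
  << e' t , y >> = sin delta * << shape (q t) (q' t) , y >> + << e' t , M t >> * << M t , y >>.
Proof.
  intros Ht. destruct (Hgeo t (Hin t Ht)) as (Hs & Hut & _).
  destruct (HLs t Ht) as (HLt & Hq & _).
  apply (chord_end_acceleration (p t) (v t) (L t) rho (k t) (L' t)); try assumption.
  - lra.
  - apply geodesic_curvature, Hin, Ht.
  - now apply chord_end_derive_tangent.
Qed.

Lemma transport_units (t : R) : Rabs (t - t1) < r ->
  << v t , v t >> = 1 /\ << N (p t) , N (p t) >> = 1 /\ << v t , N (p t) >> = 0 /\
  << e t , e t >> = 1 /\ << M t , M t >> = 1 /\ << u t , u t >> = 1 /\
  << e t , M t >> = sin delta /\ << v t , e t >> = cos delta /\ << N (p t) , e t >> = - sin delta.
Proof.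
  intros Ht. destruct (Hgeo t (Hin t Ht)) as (Hs & Hut & _).
  destruct (HLs t Ht) as (HLt & Hq & _). assert (HL0 : 0 < L t) by lra.
  destruct (chord_end_tangent (p t) (v t) (L t) Hs Hut HL0 Hq) as (_ & Hu & _).
  pose proof Hut as (_ & Hv1 & Hv2).
  repeat split; try assumption.
  - apply normal_unit, Hs.
  - now apply ray_unit.
  - apply normal_unit, Hq.
  - now apply chord_angle.
  - unfold e, ray. dot_expand. rewrite Hv1, Hv2. ring.
  - rewrite dot_comm. now apply ray_dot_normal.
Qed.

(** The first relation differentiates [e] at [p]; the second solves [q' = <q', u> u] for [e'] after
    [v] and [u] are rewritten through [e], [N] and [M]. *)
Lemma transport_relations (t : R) (y : nat -> R) : Rabs (t - t1) < r ->
  << e' t , y >> = cos delta * k t * << N (p t) , y >> - sin delta * << S t , y >> /\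
  cos delta * L t * << e' t , y >> =
    (<< q' t , u t >> - rho - cos delta * L' t) * << e t , y >>
    - rho * sin delta * << N (p t) , y >> - << q' t , u t >> * sin delta * << M t , y >>.
Proof.
  intros Ht. pose proof cos_delta_gt0 as Hc. split; [unfold e'; dot_expand; ring|].
  pose proof (transport_velocity t y Ht) as Hvel. set (sg := << q' t , u t >>) in *.
  unfold q' in Hvel. unfold u in Hvel. revert Hvel. dot_expand. intros Hvel.
  assert (Ev : cos delta * << v t , y >> = << e t , y >> + sin delta * << N (p t) , y >>).
  { unfold e, ray. dot_expand. ring. }
  apply (f_equal (Rmult (cos delta))) in Hvel.
  replace (cos delta * (sg * (/ cos delta * (<< e t, y >> - sin delta * << M t, y >>)))) with
    (sg * (<< e t, y >> - sin delta * << M t, y >>)) in Hvel by (field; lra).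
  replace (cos delta * (rho * << v t, y >> + (L' t * << e t, y >> + L t * << e' t, y >>))) with
    (rho * (cos delta * << v t , y >>) + cos delta * L' t * << e t, y >>
     + cos delta * L t * << e' t , y >>) in Hvel by ring.
  rewrite Ev in Hvel. lra.
Qed.

(** [k] and [e'] are controlled by the bound [B] on the shape operator. [L'] is controlled by
    tangency of [q']: in [<M, q'> = 0] its coefficient is [<e, M> = sin delta]. *)
Lemma transport_bounds : exists K, 0 <= K /\ forall t, Rabs (t - t1) < r ->
  Rabs (k t) <= K /\ Rabs << e' t , M t >> <= K /\ Rabs (L' t) <= K /\ Rabs << q' t , u t >> <= K.
Proof.
  pose proof sin_delta_gt0 as Hsn. pose proof cos_delta_gt0 as Hcs.
  pose proof sin2_cos2_delta as Hsc.
  (* The bound for [L']: [2 * L1] bounds [L], [2 * B] bounds [e'] against unit vectors. *)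
  set (K1 := (rho + 2 * L1 * (2 * B)) / sin delta).
  assert (HK1 : 0 <= K1).
  { unfold K1. apply Rmult_le_pos; [nra|]. left. now apply Rinv_0_lt_compat. }
  exists (2 * B + K1 + (rho + K1 + 2 * L1 * (2 * B))). split; [nra|].
  intros t Ht. destruct (transport_units t Ht) as (Hv1 & Hn1 & Hvn & He1 & HM1 & Hu1 & HeM & _).
  assert (Hk : Rabs (k t) <= B).
  { rewrite geodesic_curvature, Rabs_Ropp by (apply Hin, Ht).
    apply dot_unit_bound; [exact HB|now apply HSB|exact Hv1]. }
  assert (He' : forall x, << x , x >> = 1 -> Rabs << e' t , x >> <= 2 * B).
  { intros x Hx. rewrite (proj1 (transport_relations t x Ht)).
    unfold Rminus. eapply Rle_trans; [apply Rabs_triang|].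
    rewrite Rabs_Ropp, !Rabs_mult, (Rabs_pos_eq (cos delta)), (Rabs_pos_eq (sin delta)) by lra.
    pose proof (dot_unit_le1 _ _ Hn1 Hx) as HNx.
    pose proof (dot_unit_bound _ _ B HB (HSB t Ht) Hx) as HSx. fold (S t) in HSx.
    pose proof (Rabs_pos << N (p t) , x >>). pose proof (Rabs_pos << S t , x >>).
    pose proof (Rabs_pos (k t)).
    assert (cos delta <= 1) by nra. assert (sin delta <= 1) by nra.
    assert (cos delta * Rabs (k t) <= B) by nra.
    assert (cos delta * Rabs (k t) * Rabs << N (p t) , x >> <= B) by nra.
    assert (sin delta * Rabs << S t , x >> <= B) by nra. lra. }
  destruct (HLs t Ht) as ([HLa HLb] & _).
  pose proof (He' _ HM1) as HeMb. pose proof (He' _ Hu1) as Heub.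
  pose proof (Rabs_pos << e' t , M t >>) as Hp1. pose proof (Rabs_pos << e' t , u t >>) as Hp2.
  assert (HLM : L t * Rabs << e' t , M t >> <= 2 * L1 * (2 * B)) by nra.
  assert (HLu : L t * Rabs << e' t , u t >> <= 2 * L1 * (2 * B)) by nra.
  assert (HL' : Rabs (L' t) <= K1).
  { pose proof (chord_end_derive_tangent t Ht) as H0. revert H0. unfold q'. dot_expand.
    rewrite (dot_comm d (M t) (e t)), HeM, (dot_comm d (M t) (e' t)), (dot_comm d (M t) (v t)).
    intros H0. unfold K1. apply (Rmult_le_reg_r (sin delta)); [exact Hsn|].
    unfold Rdiv. rewrite Rmult_assoc, Rinv_l, Rmult_1_r by lra.
    rewrite <- (Rabs_pos_eq (sin delta)) at 1 by lra. rewrite <- Rabs_mult.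
    replace (L' t * sin delta) with
      (- (rho * << v t , M t >>) + - (L t * << e' t , M t >>)) by lra.
    eapply Rle_trans; [apply Rabs_triang|]. rewrite !Rabs_Ropp, !Rabs_mult.
    rewrite (Rabs_pos_eq rho), (Rabs_pos_eq (L t)) by lra.
    pose proof (dot_unit_le1 _ _ Hv1 HM1). nra. }
  assert (Hsg : Rabs << q' t , u t >> <= rho + K1 + 2 * L1 * (2 * B)).
  { unfold q'. dot_expand. eapply Rle_trans; [apply Rabs_triang|].
    eapply Rle_trans; [apply Rplus_le_compat_l, Rabs_triang|].
    rewrite !Rabs_mult, (Rabs_pos_eq rho), (Rabs_pos_eq (L t)) by lra.
    pose proof (dot_unit_le1 _ _ Hv1 Hu1). pose proof (dot_unit_le1 _ _ He1 Hu1).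
    pose proof (Rabs_pos << e t , u t >>). pose proof (Rabs_pos (L' t)).
    assert (rho * Rabs << v t , u t >> <= rho) by nra.
    assert (Rabs (L' t) * Rabs << e t , u t >> <= K1) by nra. lra. }
  assert (0 <= 2 * L1 * (2 * B)) by nra.
  repeat split; lra.
Qed.

(* Paired with a fixed vector, the chord direction and the two normals satisfy a
   closed linear system, so orthogonality at one time propagates. *)
Lemma transport_orthogonal (ts t : R) (y : nat -> R) :
  Rabs (ts - t1) < r -> Rabs (t - t1) < r ->
  << e ts , y >> = 0 -> << N (p ts) , y >> = 0 -> << M ts , y >> = 0 ->
  << e t , y >> = 0 /\ << N (p t) , y >> = 0 /\ << M t , y >> = 0.
Proof.
  intros Hts Ht HA HB' HC. destruct transport_bounds as (K & HK & Hb).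
  pose proof sin_delta_gt0 as Hsn. pose proof cos_delta_gt0 as Hcs.
  pose proof sin2_cos2_delta as Hsc.
  (* The bound for [e']: in the second relation its coefficient is [cos delta * L], with
     [L > L1 / 2]. *)
  set (K3 := (K + rho + K) / (cos delta * (L1 / 2))).
  assert (Hcl : 0 < cos delta * (L1 / 2)) by nra.
  assert (HK3 : 0 <= K3).
  { unfold K3. apply Rmult_le_pos; [lra|]. left. now apply Rinv_0_lt_compat. }
  (* The bound for [N'] and [M'], each obtained from [e'] by a relation in which it has coefficient
     [sin delta] up to sign. *)
  set (K4 := (K + K3) / sin delta).
  assert (HK4 : 0 <= K4).
  { unfold K4. apply Rmult_le_pos; [lra|]. left. now apply Rinv_0_lt_compat. }
  apply (linear_system3_zero (fun s => << e s , y >>) (fun s => << N (p s) , y >>)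
    (fun s => << M s , y >>) (fun s => << e' s , y >>) (fun s => << S s , y >>)
    (fun s => << shape (q s) (q' s) , y >>) (K3 + K4) t1 r ts t); try assumption; [lra|].
  intros s Hs. destruct (Hgeo s (Hin s Hs)) as (Hsp & _ & Dp & _).
  split; [apply is_derive_dot_const; now apply chord_dir_derive|].
  split; [apply (is_derive_dot_const d (fun w => N (p w))); now apply normal_chain|].
  split.
  { apply (is_derive_dot_const d M). apply normal_chain;
      [apply vec_chord_end|now apply chord_end_derive|apply HLs, Hs]. }
  cbv zeta. set (m := Rabs << e s , y >> + Rabs << N (p s) , y >> + Rabs << M s , y >>).
  destruct (Hb s Hs) as (Hk & Heta & HL' & Hsg).
  destruct (transport_relations s y Hs) as [R1 R3].
  pose proof (transport_acceleration s y Hs) as R2.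
  destruct (HLs s Hs) as ([HLa _] & _).
  pose proof (Rabs_pos << e s , y >>) as PA. pose proof (Rabs_pos << N (p s) , y >>) as PB.
  pose proof (Rabs_pos << M s , y >>) as PC.
  assert (Hm : 0 <= m) by (unfold m; lra).
  assert (cos delta <= 1) by nra. assert (sin delta <= 1) by nra.
  assert (HA' : Rabs << e' s , y >> <= K3 * m).
  { assert (Hx : cos delta * (L1 / 2) * Rabs << e' s , y >> <= (K + rho + K) * m).
    { apply Rle_trans with (Rabs (cos delta * L s * << e' s , y >>)).
      - rewrite (Rabs_mult _ << e' s , y >>), (Rabs_pos_eq (cos delta * L s)) by nra.
        apply Rmult_le_compat_r; [apply Rabs_pos|nra].
      - rewrite R3. unfold Rminus at 1 2. eapply Rle_trans; [apply Rabs_triang|].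
        eapply Rle_trans; [apply Rplus_le_compat_r, Rabs_triang|].
        rewrite !Rabs_Ropp, !Rabs_mult, (Rabs_pos_eq rho), (Rabs_pos_eq (sin delta)) by lra.
        assert (Hw1 : Rabs (<< q' s , u s >> - rho - cos delta * L' s) <= K + rho + K).
        { unfold Rminus. eapply Rle_trans; [apply Rabs_triang|].
          eapply Rle_trans; [apply Rplus_le_compat_r, Rabs_triang|].
          rewrite !Rabs_Ropp, Rabs_mult, (Rabs_pos_eq rho), (Rabs_pos_eq (cos delta)) by lra.
          pose proof (Rabs_pos (L' s)). nra. }
        pose proof (Rabs_pos << q' s , u s >>).
        assert (Hw2 : rho * sin delta <= K + rho + K) by nra.
        assert (Hw3 : Rabs << q' s , u s >> * sin delta <= K + rho + K) by nra.
        unfold m. apply (Rmult_le_compat_r _ _ _ PA) in Hw1.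
        apply (Rmult_le_compat_r _ _ _ PB) in Hw2. apply (Rmult_le_compat_r _ _ _ PC) in Hw3. lra. }
    unfold K3. apply (Rmult_le_reg_l (cos delta * (L1 / 2))); [exact Hcl|].
    eapply Rle_trans; [exact Hx|]. right. field. lra. }
  assert (Hdiv : forall x z, Rabs x <= K -> 0 <= Rabs z <= m ->
     forall w, sin delta * w = x * z \/ sin delta * w = x * z - << e' s , y >> \/
        sin delta * w = << e' s , y >> - x * z -> Rabs w <= K4 * m).
  { intros x z Hx Hz w Hw.
    assert (Hxz : Rabs (x * z) <= K * m) by (rewrite Rabs_mult; pose proof (Rabs_pos x); nra).
    pose proof (Rabs_pos << e' s , y >>) as PE.
    assert (Hsw : Rabs (sin delta * w) <= (K + K3) * m).
    { destruct Hw as [-> | [-> | ->]]; unfold Rminus; try (eapply Rle_trans; [apply Rabs_triang|]);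
        rewrite ?Rabs_Ropp; lra. }
    rewrite Rabs_mult, (Rabs_pos_eq (sin delta)) in Hsw by lra.
    apply (Rmult_le_reg_l (sin delta)); [exact Hsn|].
    eapply Rle_trans; [exact Hsw|]. right. unfold K4. field. lra. }
  split; [nra|]. split.
  - apply Rle_trans with (K4 * m); [|nra].
    apply (Hdiv (cos delta * k s) << N (p s) , y >>); [|unfold m; lra|right; left; lra].
    rewrite Rabs_mult, (Rabs_pos_eq (cos delta)) by lra. pose proof (Rabs_pos (k s)). nra.
  - apply Rle_trans with (K4 * m); [|nra].
    apply (Hdiv << e' s , M s >> << M s , y >>); [exact Heta|unfold m; lra|right; right; lra].
Qed.

(** If [q'] vanished, [M'] would too, and [e'] would be a multiple of [M]; being orthogonal to [e],
    which is not orthogonal to [M], it would be zero. Then [rho v + L' e = 0], impossible because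
    [e] has a normal component and [v] has none. *)
Lemma transport_speed_neq0 (t : R) : Rabs (t - t1) < r -> << q' t , u t >> <> 0.
Proof.
  intros Ht H0. pose proof sin_delta_gt0 as Hsn.
  destruct (transport_units t Ht) as (Hv1 & Hn1 & Hvn & He1 & HM1 & Hu1 & HeM & Hve & HNe).
  assert (Hq0 : forall y, << q' t , y >> = 0).
  { intros y. rewrite (transport_velocity t y Ht), H0. ring. }
  assert (Hsh : forall y, << shape (q t) (q' t) , y >> = 0).
  { intros y. rewrite (shape_ext (q t) (q' t) (vscale 0 (q' t))).
    - rewrite shape_vscale, dot_vscale_l. ring.
    - intros i Hi. pose proof (dot_self_coord_le d (q' t) i Hi) as Hc. rewrite Hq0 in Hc.
      unfold vscale. nra. }
  assert (Hacc : forall y, << e' t , y >> = << e' t , M t >> * << M t , y >>).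
  { intros y. rewrite (transport_acceleration t y Ht) at 1. rewrite Hsh. ring. }
  destruct (Hgeo t (Hin t Ht)) as (Hs & Hut & _).
  assert (Heta : << e' t , M t >> = 0).
  { assert (He0 : << e' t , e t >> = 0).
    { apply (chord_dir_dot (p t) (v t) rho (k t)); try assumption.
      apply geodesic_curvature, Hin, Ht. }
    rewrite Hacc, (dot_comm d (M t)), HeM in He0. nra. }
  assert (He'0 : forall y, << e' t , y >> = 0) by (intros y; rewrite Hacc, Heta; ring).
  pose proof (Hq0 (v t)) as Hqv. pose proof (Hq0 (N (p t))) as HqN.
  revert Hqv HqN. unfold q'. dot_expand. rewrite !He'0, Hv1, Hvn.
  rewrite (dot_comm d (e t) (N (p t))), (dot_comm d (e t) (v t)), HNe, Hve.
  intros Hqv HqN. assert (L' t = 0) by nra. nra.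
Qed.

Lemma transport_principal (ts t : R) :
  Rabs (ts - t1) < r -> Rabs (t - t1) < r -> principal_at ts ->
  principal_at t /\
  forall y, << v ts , y >> = 0 -> << N (p ts) , y >> = 0 ->
    << v t , y >> = 0 /\ << N (p t) , y >> = 0.
Proof.
  intros Hts Ht [lam Hlam].
  pose proof sin_delta_gt0 as Hsn. pose proof cos_delta_gt0 as Hcs.
  assert (Hort : forall s, Rabs (s - t1) < r -> forall y,
            << v ts , y >> = 0 -> << N (p ts) , y >> = 0 ->
            << v s , y >> = 0 /\ << N (p s) , y >> = 0).
  { intros s Hs y Hvy HNy.
    assert (Hey : << e ts , y >> = 0) by (unfold e, ray; dot_expand; rewrite Hvy, HNy; ring).
    assert (HSy : << S ts , y >> = 0).
    { unfold S. rewrite shape_vscale, dot_vscale_l.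
      rewrite (dot_ext d _ y (vscale lam (v ts)) y Hlam (fun _ _ => eq_refl)).
      rewrite dot_vscale_l, Hvy. ring. }
    destruct (transport_relations ts y Hts) as [R1 R3].
    rewrite HSy, HNy in R1. rewrite R1, Hey, HNy in R3.
    (* Every term of the second relation except the one in [M] has been shown to vanish. *)
    assert (HM : << M ts , y >> = 0).
    { pose proof (transport_speed_neq0 ts Hts) as Hn.
      assert (Hz : << q' ts , u ts >> * (sin delta * << M ts , y >>) = 0) by lra.
      apply Rmult_integral in Hz. destruct Hz as [Hz|Hz]; [now elim Hn|].
      apply Rmult_integral in Hz. destruct Hz as [Hz|Hz]; [lra|exact Hz]. }
    destruct (transport_orthogonal ts s y Hts Hs Hey HNy HM) as (HA & HBs & _).
    split; [|exact HBs].
    assert (Ev : cos delta * << v s , y >> = << e s , y >> + sin delta * << N (p s) , y >>).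
    { unfold e, ray. dot_expand. ring. }
    rewrite HA, HBs in Ev. nra. }
  split; [|exact (Hort t Ht)].
  destruct (Hgeo t (Hin t Ht)) as (Hs & Hut & Dp & _).
  (* [S] is the derivative of the normal, whose pairing with such a [y] is zero throughout the
     neighbourhood. *)
  assert (HSy : forall y, << v ts , y >> = 0 -> << N (p ts) , y >> = 0 -> << S t , y >> = 0).
  { intros y Hvy HNy.
    apply (is_derive_loc_const (fun w => << N (p w) , y >>) t _ 0).
    - apply (is_derive_dot_const d (fun w => N (p w))). now apply normal_chain.
    - apply (locally_ball t _ Ht). intros s Hs'. now apply Hort. }
  destruct (transport_units ts Hts) as (Tv1 & Tn1 & Tvn & _).
  destruct (transport_units t Ht) as (Hv1 & Hn1 & Hvn & _).
  pose proof (vec_normal _ (Hvp ts)) as Hnv.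
  pose proof (plane_decomposition (v ts) (N (p ts)) (v t) (Hvv ts) Hnv Tv1 Tn1 Tvn
    (fun y Hy Hy' => proj1 (Hort t Ht y Hy Hy'))) as Pv.
  pose proof (plane_decomposition (v ts) (N (p ts)) (N (p t)) (Hvv ts) Hnv Tv1 Tn1 Tvn
    (fun y Hy Hy' => proj2 (Hort t Ht y Hy Hy'))) as Pn.
  pose proof (plane_decomposition (v ts) (N (p ts)) (S t) (Hvv ts) Hnv Tv1 Tn1 Tvn HSy) as PS.
  assert (HSn : << S t , N (p t) >> = 0) by (apply shape_dot_normal, Hs).
  set (al := << S t , v t >>).
  assert (Hss : << S t , S t >> = al * al).
  { pose proof (Pv (v t)) as Q1. pose proof (Pn (N (p t))) as Q2. pose proof (Pv (N (p t))) as Q3.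
    pose proof (PS (S t)) as Q4. pose proof (PS (v t)) as Q5. pose proof (PS (N (p t))) as Q6.
    fold al in Q5.
    rewrite Hv1 in Q1. rewrite Hn1 in Q2. rewrite Hvn in Q3. rewrite HSn in Q6.
    rewrite ?(dot_comm d (v ts) (v t)), ?(dot_comm d (N (p ts)) (v t)),
      ?(dot_comm d (v ts) (N (p t))), ?(dot_comm d (N (p ts)) (N (p t))),
      ?(dot_comm d (v ts) (S t)), ?(dot_comm d (N (p ts)) (S t)) in *.
    set (v1 := << v t , v ts >>) in *. set (v2 := << v t , N (p ts) >>) in *.
    set (n1 := << N (p t) , v ts >>) in *. set (n2 := << N (p t) , N (p ts) >>) in *.
    set (s1 := << S t , v ts >>) in *. set (s2 := << S t , N (p ts) >>) in *.
    (* Determinant of the frame [v t], [N (p t)] in the basis taken at [ts]. Lagrange's identity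
       gives [D * D = 1], and Cramer's rule gives the coordinates of [S t] from its pairings [al]
       with [v t] and 0 with [N (p t)]. *)
    set (D := v1 * n2 - v2 * n1).
    assert (HD : D * D = 1).
    { transitivity ((v1 * v1 + v2 * v2) * (n1 * n1 + n2 * n2)
                    - (v1 * n1 + v2 * n2) * (v1 * n1 + v2 * n2)); [unfold D; ring|].
      rewrite <- Q1, <- Q2, <- Q3. ring. }
    assert (E1 : s1 * D = al * n2).
    { transitivity ((s1 * v1 + s2 * v2) * n2 - (s1 * n1 + s2 * n2) * v2); [unfold D; ring|].
      rewrite <- Q5, <- Q6. ring. }
    assert (E2 : s2 * D = - (al * n1)).
    { transitivity ((s1 * n1 + s2 * n2) * v1 - (s1 * v1 + s2 * v2) * n1); [unfold D; ring|].
      rewrite <- Q5, <- Q6. ring. }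
    rewrite Q4. transitivity ((s1 * D) * (s1 * D) + (s2 * D) * (s2 * D)).
    - transitivity ((s1 * s1 + s2 * s2) * (D * D)); [rewrite HD; ring|ring].
    - rewrite E1, E2. transitivity (al * al * (n1 * n1 + n2 * n2)); [ring|].
      rewrite <- Q2. ring. }
  assert (Hz : << vsub (S t) (vscale al (v t)) , vsub (S t) (vscale al (v t)) >> = 0).
  { dot_expand. rewrite Hss, Hv1, (dot_comm d (v t) (S t)). fold al. ring. }
  (* [S t] is the shape operator at [rho] times [v t], hence the division. *)
  exists (al / rho). intros i Hi.
  pose proof (dot_self_coord_le d (vsub (S t) (vscale al (v t))) i Hi) as Hc. rewrite Hz in Hc.
  assert (Hi0 : S t i = al * v t i).
  { revert Hc. unfold vsub, vscale. intros Hc. nra. }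
  revert Hi0. unfold S. rewrite shape_vscale. unfold vscale. intros Hi0.
  apply (Rmult_eq_reg_l rho); [|lra]. rewrite Hi0. field. lra.
Qed.

End Transport.

(** One chord is found at [t1] and continued to nearby times, with all bounds on a common
    neighbourhood. The principal time [ts] may be anywhere in it, as the propagation argument
    requires. *)
Lemma principal_locally (t1 : R) : a < t1 < b ->
  exists eps, 0 < eps /\ forall ts t, Rabs (ts - t1) < eps -> Rabs (t - t1) < eps ->
    principal_at ts ->
    principal_at t /\
    forall y, << v ts , y >> = 0 -> << N (p ts) , y >> = 0 ->
      << v t , y >> = 0 /\ << N (p t) , y >> = 0.
Proof.
  intros Ht1. destruct (interval_ball t1 Ht1) as (r0 & Hr0 & Hin).
  destruct (Hgeo t1 Ht1) as (Hs & Hut & _).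
  destruct (chord_exists (p t1) (v t1) Hs Hut) as (L1 & HL1 & Hq).
  destruct (chord_family p v t1 r0 L1 Hvp Hvv Hr0) as (r1 & L & L' & Hr1 & Hr10 & _ & Hall);
    try assumption.
  { intros s Hs'. destruct (Hgeo s (Hin s Hs')) as (Ha & Hb & Hc & Hd).
    split; [exact Ha|]. split; [exact Hb|]. split; eexists; eassumption. }
  destruct (shape_speed_bounded t1 Ht1) as (B & HB & [r2 Hr2]).
  exists (Rmin r1 r2). pose proof (Rmin_l r1 r2). pose proof (Rmin_r r1 r2).
  split; [apply Rmin_glb_lt; [lra|apply cond_pos]|].
  intros ts t Hts Ht. apply (transport_principal t1 (Rmin r1 r2) B L1 L L'); try assumption.
  - intros s Hs'. apply Hin. lra.
  - intros s Hs'. apply Hall. lra.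
  - intros s Hs'. apply Hr2. unfold ball; simpl; unfold AbsRing_ball, abs, minus, plus, opp; simpl.
    fold (s - t1). lra.
Qed.

(** Both conclusions travel together: the local step starts from a time already reached, and a
    vector orthogonal to the plane at [t0] is by then known to be orthogonal to the plane there. *)
Lemma principal_geodesic (t0 t : R) :
  a < t0 < b -> a < t < b -> principal_at t0 ->
  principal_at t /\
  forall y, << v t0 , y >> = 0 -> << N (p t0) , y >> = 0 ->
    << v t , y >> = 0 /\ << N (p t) , y >> = 0.
Proof.
  intros Ht0 Ht H0.
  apply (interval_propagation (fun t => principal_at t /\
    forall y, << v t0 , y >> = 0 -> << N (p t0) , y >> = 0 ->
      << v t , y >> = 0 /\ << N (p t) , y >> = 0) a b t0 t); try assumption.
  - intros t1 Ht1. destruct (principal_locally t1 Ht1) as (eps & He & Hp).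
    exists eps. split; [exact He|]. intros s s' Hs Hs' [Ps Os].
    destruct (Hp s s' Hs Hs' Ps) as [Ps' Os']. split; [exact Ps'|].
    intros y Hy Hy'. destruct (Os y Hy Hy'). now apply Os'.
  - split; [exact H0|]. auto.
Qed.

Lemma principal_geodesic_planar (t0 t : R) :
  a < t0 < b -> a < t < b -> principal_at t0 ->
  exists alpha beta, p t = vadd (p t0) (vadd (vscale alpha (v t0)) (vscale beta (N (p t0)))).
Proof.
  intros Ht0 Ht H0. destruct (Hgeo t0 Ht0) as (Hs & (_ & Hv1 & Hv2) & _).
  pose proof (vec_normal _ (Hvp t0)) as Hnv.
  set (x := vsub (p t) (p t0)).
  assert (Hx : forall y, << v t0 , y >> = 0 -> << N (p t0) , y >> = 0 -> << x , y >> = 0).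
  { intros y Hy Hy'. unfold x. rewrite dot_vsub_l.
    (* The derivative of this pairing is [rho] times that of [v] with [y], which vanishes at all
       times. *)
    rewrite (derive_zero_const (fun s => << p s , y >>) a b) with (s := t) (t := t0); try assumption.
    - ring.
    - intros s Hs'. destruct (Hgeo s Hs') as (_ & _ & Dp & _).
      eapply is_derive_eq; [apply is_derive_dot_const, Dp|].
      rewrite dot_vscale_l, (proj1 (proj2 (principal_geodesic t0 s Ht0 Hs' H0) y Hy Hy')). ring. }
  pose proof (plane_decomposition (v t0) (N (p t0)) x (Hvv t0) Hnv Hv1 (normal_unit _ Hs) Hv2 Hx) as Px.
  exists << x , v t0 >>, << x , N (p t0) >>.
  set (z := vsub x (vadd (vscale << x , v t0 >> (v t0)) (vscale << x , N (p t0) >> (N (p t0))))).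
  assert (Hz : z = (fun _ => 0)).
  { apply (dot_self_eq0 d).
    - pose proof (Hvp t). pose proof (Hvp t0). pose proof (Hvv t0). unfold z, x. auto with vecs.
    - unfold z at 1. rewrite dot_vsub_l, Px. dot_expand. ring. }
  apply functional_extensionality; intros i. apply (f_equal (fun f => f i)) in Hz.
  revert Hz. unfold z, x, vsub, vadd, vscale. lra.
Qed.

End Geodesic.
End Hypersurface.

(** * From the smooth table and the given geodesic to the setting above *)

Lemma continuous_Rd_ext (d : nat) (f g : (nat -> R) -> R) :
  (forall x, vec d x -> f x = g x) -> continuous_Rd d f -> continuous_Rd d g.
Proof.
  intros Hfg Hf x Hx eps He. destruct (Hf x Hx eps He) as (del & Hdel & Hc).
  exists del. split; [exact Hdel|]. intros y Hy. rewrite <- !Hfg by assumption. now apply Hc.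
Qed.

(** [Ck] hides its partial derivatives behind existentials. [Derive] names them, which lets the
    Hessian be formed as a single function, and agrees with each witness on vectors of R^d. *)
Lemma is_C1_of_Ck1 (d : nat) (f g : (nat -> R) -> R) :
  Ck d 1 g -> (forall x, vec d x -> f x = g x) ->
  is_C1 d f (fun x i => Derive (fun t => f (vadd x (vscale t (ebasis i)))) 0).
Proof.
  intros [_ Hg] Hfg.
  assert (Hd : forall i, (i < d)%nat -> exists g', continuous_Rd d g' /\ forall x, vec d x ->
    is_derive (fun t => f (vadd x (vscale t (ebasis i)))) 0 (g' x)).
  { intros i Hi. destruct (Hg i Hi) as (g' & Hg' & Hc). exists g'. split; [exact Hc|].
    intros x Hx. apply (is_derive_ext (fun t => g (vadd x (vscale t (ebasis i))))).
    - intros t. symmetry. apply Hfg. auto with vecs.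
    - apply is_derive_Reals, Hg', Hx. }
  split.
  - intros x i Hx Hi. destruct (Hd i Hi) as (g' & _ & Hg'). apply Derive_correct.
    eexists. now apply Hg'.
  - intros i Hi. destruct (Hd i Hi) as (g' & Hc & Hg'). revert Hc. apply continuous_Rd_ext.
    intros x Hx. symmetry. apply is_derive_unique, Hg', Hx.
Qed.

Definition hessian (G : (nat -> R) -> nat -> R) (x : nat -> R) (j i : nat) : R :=
  Derive (fun t => G (vadd x (vscale t (ebasis i))) j) 0.

(** [G] comes from [is_gradient] and the regular partial derivatives from [Ck]; uniqueness of
    derivatives identifies the two. *)
Lemma smooth_C2 (d : nat) (F : (nat -> R) -> R) (G : (nat -> R) -> nat -> R) :
  Ck d 2 F -> is_gradient d F G ->
  is_C1 d F G /\ forall k, (k < d)%nat -> is_C1 d (fun x => G x k) (fun x => hessian G x k).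
Proof.
  intros [_ HF] HG.
  assert (Hg : forall i, (i < d)%nat -> exists g, Ck d 1 g /\ forall x, vec d x -> G x i = g x).
  { intros i Hi. destruct (HF i Hi) as (g & Hg & Hc). exists g. split; [exact Hc|].
    intros x Hx. eapply uniqueness_limite; [apply HG; assumption|now apply Hg]. }
  split; [split|].
  - intros x i Hx Hi. apply is_derive_Reals. now apply HG.
  - intros i Hi. destruct (Hg i Hi) as (g & [Hc _] & He). revert Hc. apply continuous_Rd_ext.
    intros x Hx. symmetry. now apply He.
  - intros k Hk. destruct (Hg k Hk) as (g & Hc & He).
    exact (is_C1_of_Ck1 d (fun x => G x k) g Hc He).
Qed.

Lemma geodesic_constant_speed (d : nat) (F : (nat -> R) -> R) (G : (nat -> R) -> nat -> R)
    (a b : R) (gam gam1 gam2 : R -> nat -> R) :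
  geodesic d F G a b gam gam1 gam2 ->
  (forall t, a < t < b -> dot d (gam1 t) (normal d G (gam t)) = 0) ->
  forall s t, a < s < b -> a < t < b -> dot d (gam1 s) (gam1 s) = dot d (gam1 t) (gam1 t).
Proof.
  intros [_ Hgeo] Htan. apply (derive_zero_const (fun s => dot d (gam1 s) (gam1 s))).
  intros t Ht. destruct (Hgeo t Ht) as (_ & _ & _ & _ & D2 & _ & mu & Hmu).
  assert (Dv : is_vderive d gam1 t (gam2 t)) by (intros i Hi; apply is_derive_Reals, D2, Hi).
  eapply is_derive_eq; [apply (is_derive_dot d gam1 gam1); exact Dv|].
  rewrite Hmu. dot_expand. rewrite (dot_comm d (normal d G (gam t))), Htan by exact Ht. ring.
Qed.

Theorem theorem2p5 :
  forall (d : nat) (F : (nat -> R) -> R) (G : (nat -> R) -> nat -> R),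
  gutkin_table d F G ->
  forall (a b : R) (gam gam1 gam2 : R -> nat -> R),
  geodesic d F G a b gam gam1 gam2 ->
  forall t0, a < t0 < b ->
  principal_direction d G (gam t0) (gam1 t0) ->
  (forall t, a < t < b ->
     exists alpha beta : R,
       gam t = vadd (gam t0)
                 (vadd (vscale alpha (gam1 t0)) (vscale beta (normal d G (gam t0))))) /\
  (forall t, a < t < b -> principal_direction d G (gam t) (gam1 t)).
Proof.
  intros d F G [(Hsm & Hgrad & Hreg & [Mb Hbd] & Hcvx & _) (delta & Hdelta & Hgut)]
    a b gam gam1 gam2 Hgeod t0 Ht0 Hprin.
  destruct (smooth_C2 d F G (Hsm 2%nat) Hgrad) as [HF HG].
  assert (HGv : forall x, vec d x -> vec d (G x)) by (intros x Hx; now apply Hgrad).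
  pose proof Hgeod as [_ Hgeo].
  (* Outside [(a, b)] the curve need not consist of vectors of R^d, while the chain rule asks for
     them at all times; truncation repairs this and changes nothing inside the interval. *)
  set (cut := fun (x : nat -> R) (i : nat) => if Nat.ltb i d then x i else 0).
  assert (Hcutv : forall x, vec d (cut x)).
  { intros x i Hi. unfold cut. destruct (Nat.ltb_spec i d); [lia|reflexivity]. }
  assert (Hcut : forall x i, (i < d)%nat -> cut x i = x i).
  { intros x i Hi. unfold cut. destruct (Nat.ltb_spec i d); [reflexivity|lia]. }
  assert (Hcutid : forall x, vec d x -> cut x = x) by (intros x Hx; apply (vec_ext d); auto).
  set (p := fun s => cut (gam s)).
  assert (Hp : forall t, a < t < b -> p t = gam t) by (intros t Ht; apply Hcutid, (Hgeo t Ht)).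
  assert (Dp : forall t, a < t < b -> is_vderive d p t (gam1 t)).
  { intros t Ht i Hi. destruct (Hgeo t Ht) as (_ & _ & _ & D1 & _).
    apply (is_derive_ext (fun s => gam s i)); [intros s; symmetry; now apply Hcut|].
    apply is_derive_Reals, D1, Hi. }
  assert (Htan : forall t, a < t < b -> dot d (gam1 t) (normal d G (gam t)) = 0).
  { intros t Ht. rewrite dot_comm, <- Hp by exact Ht.
    apply (surface_curve_tangent d F G HF HGv Hreg p t); [intros; apply Hcutv|now apply Dp|].
    destruct (interval_ball a b t Ht) as (r & Hr & Hin).
    generalize (continuous_near R_UniformSpace (fun w => w) t _ (continuous_id t) Hr).
    apply filter_imp. intros s Hs. rewrite Hp by (apply Hin, Hs). apply Hgeo, Hin, Hs. }
  set (rho := norm d (gam1 t0)).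
  assert (Hrho2 : forall t, a < t < b -> dot d (gam1 t) (gam1 t) = rho * rho).
  { intros t Ht. unfold rho. rewrite norm_sqr.
    now apply (geodesic_constant_speed d F G a b gam gam1 gam2). }
  assert (Hrho : 0 < rho).
  { destruct (Hgeo t0 Ht0) as (_ & Hv & _ & _ & _ & Hn & _).
    apply norm_gt0, dot_self_gt0; assumption. }
  set (v := fun s => vscale (/ rho) (cut (gam1 s))).
  assert (Hv : forall t, a < t < b -> gam1 t = vscale rho (v t)).
  { intros t Ht. unfold v. rewrite Hcutid by apply (Hgeo t Ht).
    apply functional_extensionality; intros i. unfold vscale. field. lra. }
  (* As [gam2] is [mu] times a unit normal, this is [mu / rho], the rate at which the unit tangent
     turns towards the normal. *)
  set (k := fun t => / rho * dot d (gam2 t) (normal d G (gam t))).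
  assert (HG' : forall t, a < t < b -> surf d F (p t) /\ unit_tangent d G (p t) (v t) /\
    is_vderive d p t (vscale rho (v t)) /\ is_vderive d v t (vscale (k t) (normal d G (p t)))).
  { intros t Ht. destruct (Hgeo t Ht) as (Hs & Hv1 & _ & _ & D2 & _ & mu & Hmu).
    rewrite Hp by exact Ht. split; [exact Hs|]. split; [|split].
    - split; [apply vec_vscale, Hcutv|]. unfold v. rewrite Hcutid by exact Hv1. dot_expand.
      rewrite Hrho2, Htan by exact Ht. split; [field; lra|ring].
    - rewrite <- Hv by exact Ht. now apply Dp.
    - apply (is_vderive_eq d _ _ (vscale (/ rho) (gam2 t))).
      + apply is_vderive_vscale_const. intros i Hi.
        apply (is_derive_ext (fun s => gam1 s i)); [intros s; symmetry; now apply Hcut|].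
        apply is_derive_Reals, D2, Hi.
      + intros i _. unfold k. rewrite Hmu. dot_expand.
        rewrite (normal_unit d F G HGv Hreg) by exact Hs. unfold vscale. ring. }
  set (H := hessian G) in *.
  (* Eigenvectors may be rescaled, so [gam1] can be exchanged for the unit tangent [v]. *)
  assert (Heig : forall t, a < t < b ->
            principal_direction d G (gam t) (gam1 t) <-> principal_at d G H p v t).
  { intros t Ht. destruct (Hgeo t Ht) as (Hs & Hv1 & _ & _ & _ & Hn & _).
    assert (E : forall i lam, shape d G H (p t) (v t) i = lam * v t i <->
              shape d G H (gam t) (gam1 t) i = lam * gam1 t i).
    { intros i lam. rewrite Hp, (Hv t Ht), shape_vscale by exact Ht. unfold vscale at 1 2.
      split; intros Hi; [rewrite Hi; ring|].
      apply (Rmult_eq_reg_l rho); [|lra]. rewrite Hi. ring. }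
    split.
    - intros [lam Hl]. exists lam. intros i Hi. apply E.
      apply (shape_eigen_iff d F G H HG HGv Hreg) in Hl; try assumption. now apply Hl.
    - intros [lam Hl]. exists lam.
      apply (shape_eigen_iff d F G H HG HGv Hreg); try assumption.
      split; [now apply Htan|]. split; [exact Hn|]. intros i Hi. now apply E, Hl. }
  assert (H0 : principal_at d G H p v t0) by (apply Heig; assumption).
  assert (Hvp : forall s, vec d (p s)) by (intros; apply Hcutv).
  assert (Hvv : forall s, vec d (v s)) by (intros; apply vec_vscale, Hcutv).
  split; intros t Ht.
  - destruct (principal_geodesic_planar d F G H HF HG HGv Hreg delta Mb Hdelta Hbd Hcvx Hgut
      p v k rho a b Hvp Hvv Hrho HG' t0 t Ht0 Ht H0) as (al & be & E).
    (* The coordinates in the plane were taken with respect to [v t0], which is [gam1 t0] divided by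
       [rho]. *)
    exists (al / rho), be. rewrite <- (Hp t Ht), <- (Hp t0 Ht0), E, (Hv t0 Ht0).
    apply functional_extensionality; intros i. unfold vadd, vscale. field. lra.
  - apply Heig; [exact Ht|].
    apply (principal_geodesic d F G H HF HG HGv Hreg delta Mb Hdelta Hbd Hcvx Hgut
      p v k rho a b Hvp Hvv Hrho HG' t0 t Ht0 Ht H0).
Qed.
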